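(* Let $a<b$, and let $y$ be an extremal of the isoperimetric problem for $\int_a^bF(x,y,y')\,dx$ subject to the constraint $\int_a^bG(x,y,y')\,dx=\ell$ and to the mixed boundary conditions $y'(a)=0$ (free), $y(b)=B$ (fixed), with Lagrange multiplier $\lambda$ and $H=F+\lambda G$. Let $$P=\frac{\partial^2H}{\partial y'^2},\qquad R=\frac{\partial^2H}{\partial y\,\partial y'},\qquad Q=\frac{\partial^2H}{\partial y^2}-\frac{dR}{dx},\qquad T=\frac{\partial G}{\partial y}-\frac{d}{dx}\frac{\partial G}{\partial y'},$$ with all partial derivatives evaluated at $(x,y(x),y'(x))$. Suppose that $P(x)>0$ for all $x\in[a,b]$, that $T\not\equiv0$ on $[a,b]$, that $R(a)=0$, and that $\frac{\partial G}{\partial y'}=0$ at $x=a$. With $\mathbf L(w):=-\frac{d}{dx}(Pw')+Qw$, let $u=u(x)$ and $v=v(x)$ be nontrivial solutions on $[a,b]$ of $$\mathbf L(u)=0,\qquad \mathbf L(v)=T,$$ respectively, satisfying $u'(a)=0$ and $v'(a)=0$. Put $$m(x,a)=\int_a^xu(t)T(t)\,dt,\qquad n(x,a)=\int_a^xv(t)T(t)\,dt,\qquad \Delta(x,a)=m(x,a)v(x)-n(x,a)u(x).$$ Then the second variation $\delta^2J[h]=\left.Rh^2\right|_a^b+\int_a^b\left(Ph'^2+Qh^2\right)dx$ satisfies $\delta^2J[h]>0$ for every piecewise smooth $h:[a,b]\to\mathbb R$ with $h\not\equiv0$, $h'(a)=0$, $h(b)=0$ and $$\left.\frac{\partial G}{\partial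 y'}h\right|_a^b+\int_a^bhT\,dx=0$$ if and only if $\Delta(x,a)\neq0$ for all $a<x\le b$.
   Context: The functions $F=F(x,y,y')$ and $G=G(x,y,y')$ are real valued; $F$, $G$, $y$, and the functions derived from them are assumed to have continuous derivatives of as many orders as needed. An extremal of the isoperimetric problem is a function $y$ satisfying the constraint and the boundary conditions for which there is a constant $\lambda$ (Lagrange multiplier) such that $y$ satisfies the Euler--Lagrange equation $\frac{\partial H}{\partial y}-\frac{d}{dx}\frac{\partial H}{\partial y'}=0$ on $[a,b]$ with $H=F+\lambda G$; the functional $J$ is $J[y]=\int_a^bH(x,y,y')\,dx$. The symbol $'$ denotes $d/dx$. ''Piecewise smooth'' means continuous and piecewise continuously differentiable on $[a,b]$; $h'(a)$ denotes the (one-sided) derivative at $a$. The notation $\left.f\right|_a^b$ means $f(b)-f(a)$.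
   Formalization: The hypothesis that T is not identically zero on [a,b] is strengthened to: T is not identically zero on [a,c] for every a<c≤b. If T vanishes on some [a,c], then Δ(x,a)=0 there even when the second variation is positive, so the ''only if'' part would fail. *)

(* Defs.v *)
From Stdlib Require Export Reals.
From Coquelicot Require Export Coquelicot.

Open Scope R_scope.

Set Implicit Arguments.

(** A function on [[a, b]] is a function [R -> R] of which only the values on
    [[a, b]] are ever used; all derivatives are therefore taken relative to
    [[a, b]], so that they are one-sided at [a] and at [b]. *)

Definition on_itv (a b x : R) : Prop := a <= x <= b.

Definition is_deriv_on (a b : R) (f : R -> R) (x l : R) : Prop :=
  filterlim (fun t => (f t - f x) / (t - x))
    (within (on_itv a b) (locally' x)) (locally l).

(** For [a < b] and [x] in [[a, b]] this is the unique [l] such that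
    [is_deriv_on a b f x l], when there is one; otherwise it is unspecified. *)
Definition deriv_on (a b : R) (f : R -> R) (x : R) : R :=
  iota (is_deriv_on a b f x).

Definition derivable_on (a b : R) (f : R -> R) : Prop :=
  forall x, on_itv a b x -> exists l, is_deriv_on a b f x l.

Fixpoint Ck_on (k : nat) (a b : R) (f : R -> R) : Prop :=
  match k with
  | O => continuous_on (on_itv a b) f
  | S k => continuous_on (on_itv a b) f /\ derivable_on a b f /\
           Ck_on k a b (deriv_on a b f)
  end.

(** Each piece is [C^1] on the closed interval between consecutive nodes, so
    the one-sided derivatives exist and are finite at the nodes. *)
Definition piecewise_smooth (a b : R) (h : R -> R) : Prop :=
  continuous_on (on_itv a b) h /\
  exists (n : nat) (s : nat -> R),
    s O = a /\ s n = b /\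
    (forall i, (i < n)%nat -> s i < s (S i)) /\
    (forall i, (i < n)%nat -> Ck_on 1 (s i) (s (S i)) h).

Definition not_identically_zero (a b : R) (f : R -> R) : Prop :=
  exists x, on_itv a b x /\ f x <> 0.

Definition end_diff (a b : R) (f : R -> R) : R := f b - f a.

(** Lagrangians are functions of [(x, y, z)], where [z] stands for [y']. *)

Definition d_x (f : R -> R -> R -> R) : R -> R -> R -> R :=
  fun x y z => Derive (fun t => f t y z) x.
Definition d_y (f : R -> R -> R -> R) : R -> R -> R -> R :=
  fun x y z => Derive (fun t => f x t z) y.
Definition d_z (f : R -> R -> R -> R) : R -> R -> R -> R :=
  fun x y z => Derive (fun t => f x y t) z.

Definition partials_exist (Omega : R * R * R -> Prop) (f : R -> R -> R -> R)
  : Prop :=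
  forall x y z, Omega (x, y, z) ->
    ex_derive (fun t => f t y z) x /\
    ex_derive (fun t => f x t z) y /\
    ex_derive (fun t => f x y t) z.

Fixpoint Ck3 (k : nat) (Omega : R * R * R -> Prop) (f : R -> R -> R -> R)
  : Prop :=
  let cont := continuous_on Omega (fun p => f (fst (fst p)) (snd (fst p)) (snd p))
  in
  match k with
  | O => cont
  | S k => cont /\ partials_exist Omega f /\
           Ck3 k Omega (d_x f) /\ Ck3 k Omega (d_y f) /\ Ck3 k Omega (d_z f)
  end.

Definition along (a b : R) (y : R -> R) (f : R -> R -> R -> R) : R -> R :=
  fun x => f x (y x) (deriv_on a b y x).

Definition euler_lagrange (a b : R) (y : R -> R) (f : R -> R -> R -> R)
  : R -> R :=
  fun x => along a b y (d_y f) x - deriv_on a b (along a b y (d_z f)) x.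

Definition lagrangian (F G : R -> R -> R -> R) (lambda : R)
  : R -> R -> R -> R :=
  fun x y z => F x y z + lambda * G x y z.

Definition is_extremal (a b : R) (F G : R -> R -> R -> R) (ell B lambda : R)
    (y : R -> R) : Prop :=
  RInt (along a b y G) a b = ell /\
  deriv_on a b y a = 0 /\ y b = B /\
  forall x, on_itv a b x ->
    euler_lagrange a b y (lagrangian F G lambda) x = 0.

Definition coef_P (a b : R) (y : R -> R) (H : R -> R -> R -> R) : R -> R :=
  along a b y (d_z (d_z H)).

Definition coef_R (a b : R) (y : R -> R) (H : R -> R -> R -> R) : R -> R :=
  along a b y (d_y (d_z H)).

Definition coef_Q (a b : R) (y : R -> R) (H : R -> R -> R -> R) : R -> R :=
  fun x => along a b y (d_y (d_y H)) x - deriv_on a b (coef_R a b y H) x.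

Definition jacobi_op (a b : R) (P Q w : R -> R) : R -> R :=
  fun x => - deriv_on a b (fun t => P t * deriv_on a b w t) x + Q x * w x.

Definition jacobi_solution (a b : R) (P Q f w : R -> R) : Prop :=
  Ck_on 2 a b w /\ forall x, on_itv a b x -> jacobi_op a b P Q w x = f x.

(** When [h] is piecewise smooth, [deriv_on a b h] takes arbitrary values at
    the finitely many corners, which do not affect the integral. *)
Definition second_variation (a b : R) (P Q Rc h : R -> R) : R :=
  end_diff a b (fun x => Rc x * h x ^ 2) +
  RInt (fun x => P x * deriv_on a b h x ^ 2 + Q x * h x ^ 2) a b.

(* Main.v *)
From Stdlib Require Import Lra Lia Classical.
Require Import Defs.

Set Implicit Arguments.

(** Since [h(b) = 0], [R(a) = 0] and [G_{y'}(a) = 0], everything reduces to the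
    sign of [int (P h'^2 + Q h^2)] under [int h T = 0].

    If [Delta(c) = 0], some nontrivial combination [w = alpha v + beta u] has
    [w(c) = 0] and [int_a^c w T = 0]; extended by zero beyond [c], it is
    admissible and its second variation is
    [[w P w']_a^c + alpha int_a^c w T = 0].

    If [Delta <> 0] on [(a, b]], put [k(x) = int_a^x h T] and solve
    [(h, k) = alpha (u, m) + beta (v, n)] for functions [alpha], [beta]. The
    Wronskian identity [P (u' v - u v') = m] turns the integrand into
    [S' + P (h' - alpha u' - beta v')^2] with
    [S = h P (alpha u' + beta v') + beta k], and [S(b) = 0]. The determinant
    [D = u n - m v = - Delta] vanishes at [a], so on a short interval [[a, e]]
    where [u <> 0] the Jacobi identity
    [P h'^2 + Q h^2 = (P u' h^2 / u)' + P u^2 ((h/u)')^2] is used instead.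
    There [(D/u)' = m^2 / (P u^2)], and the Cauchy-Schwarz inequality bounds
    the discrepancy [(u k - m h)^2 / (u D)] of the two boundary terms at [e] by
    [int_a^e P u^2 ((h/u)')^2]. *)

(** * One-sided derivatives and extension to the whole line *)

Lemma is_deriv_on_spec (a b : R) (f : R -> R) (x l : R) :
  is_deriv_on a b f x l <->
  forall eps, 0 < eps -> exists d, 0 < d /\
    forall t, on_itv a b t -> t <> x -> Rabs (t - x) < d ->
      Rabs ((f t - f x) / (t - x) - l) < eps.
Proof.
unfold is_deriv_on. rewrite filterlim_locally. split.
- intros H eps Heps. destruct (H (mkposreal eps Heps)) as [d Hd].
  exists d; split; [apply cond_pos|]. intros t Ht Htx Hlt.
  exact (Hd t Hlt Htx Ht).
- intros H eps. destruct (H eps (cond_pos eps)) as [d [Hd0 Hd]].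
  exists (mkposreal d Hd0). intros t Hlt Htx Ht. exact (Hd t Ht Htx Hlt).
Qed.

Lemma continuous_on_spec (a b : R) (f : R -> R) :
  continuous_on (on_itv a b) f <->
  forall x, on_itv a b x -> forall eps, 0 < eps -> exists d, 0 < d /\
    forall t, on_itv a b t -> Rabs (t - x) < d -> Rabs (f t - f x) < eps.
Proof.
unfold continuous_on. split.
- intros H x Hx eps Heps. specialize (H x Hx).
  rewrite filterlim_locally in H. destruct (H (mkposreal eps Heps)) as [d Hd].
  exists d; split; [apply cond_pos|]. intros t Ht Hlt. exact (Hd t Hlt Ht).
- intros H x Hx. rewrite filterlim_locally. intros eps.
  destruct (H x Hx eps (cond_pos eps)) as [d [Hd0 Hd]].
  exists (mkposreal d Hd0). intros t Hlt Ht. exact (Hd t Ht Hlt).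
Qed.

Lemma continuous_spec (f : R -> R) (x : R) :
  continuous f x <->
  forall eps, 0 < eps -> exists d, 0 < d /\
    forall t, Rabs (t - x) < d -> Rabs (f t - f x) < eps.
Proof.
unfold continuous. rewrite filterlim_locally. split.
- intros H eps Heps. destruct (H (mkposreal eps Heps)) as [d Hd].
  exists d; split; [apply cond_pos|]. intros t Hlt. exact (Hd t Hlt).
- intros H eps. destruct (H eps (cond_pos eps)) as [d [Hd0 Hd]].
  exists (mkposreal d Hd0). intros t Hlt. exact (Hd t Hlt).
Qed.

Lemma is_derive_spec (f : R -> R) (x l : R) :
  is_derive f x l <->
  forall eps, 0 < eps -> exists d, 0 < d /\
    forall t, t <> x -> Rabs (t - x) < d ->
      Rabs ((f t - f x) / (t - x) - l) < eps.
Proof.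
rewrite is_derive_Reals. unfold derivable_pt_lim. split.
- intros H eps Heps. destruct (H eps Heps) as [d Hd].
  exists d; split; [apply cond_pos|]. intros t Htx Hlt.
  replace t with (x + (t - x)) at 1 by ring. apply Hd; [lra|exact Hlt].
- intros H eps Heps. destruct (H eps Heps) as [d [Hd0 Hd]].
  exists (mkposreal d Hd0). intros k Hk Hlt.
  replace k with (x + k - x) at 2 by ring. apply Hd; [lra|].
  replace (x + k - x) with k by ring. exact Hlt.
Qed.

(** Since [a < b], each [x] in [[a, b]] has points of [[a, b]] arbitrarily close to it on at least
    one side, so the limit is determined and [deriv_on] returns it. *)
Lemma is_deriv_on_unique (a b : R) (f : R -> R) (x l : R) :
  a < b -> on_itv a b x -> is_deriv_on a b f x l -> deriv_on a b f x = l.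
Proof.
intros Hab Hx Hl. unfold deriv_on.
apply (iota_unique (V := R_CompleteNormedModule)); [|exact Hl].
intros l' Hl'. destruct (Req_dec l' l) as [|Hne]; [assumption|exfalso].
rewrite is_deriv_on_spec in Hl, Hl'.
assert (He : 0 < Rabs (l' - l) / 2) by (apply Rdiv_lt_0_compat; [apply Rabs_pos_lt|]; lra).
destruct (Hl _ He) as [d [Hd H]]. destruct (Hl' _ He) as [d' [Hd' H']].
assert (exists t, on_itv a b t /\ t <> x /\ Rabs (t - x) < d /\ Rabs (t - x) < d')
  as (t & T1 & T2 & T3 & T4).
{ unfold on_itv in *. set (e := Rmin (Rmin d d') (b - a)).
  assert (0 < e) by (unfold e; repeat apply Rmin_glb_lt; lra).
  assert (e <= d) by (unfold e; eapply Rle_trans; [apply Rmin_l|apply Rmin_l]).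
  assert (e <= d') by (unfold e; eapply Rle_trans; [apply Rmin_l|apply Rmin_r]).
  assert (e <= b - a) by apply Rmin_r.
  destruct (Rle_dec (x + e / 2) b).
  - exists (x + e / 2). rewrite Rabs_pos_eq; lra.
  - exists (x - e / 2). rewrite Rabs_left; lra. }
specialize (H t T1 T2 T3). specialize (H' t T1 T2 T4).
assert (Rabs (l' - l) < Rabs (l' - l) / 2 + Rabs (l' - l) / 2); [|lra].
set (q := (f t - f x) / (t - x)) in *.
replace (l' - l) with ((q - l) + - (q - l')) at 1 by ring.
eapply Rle_lt_trans; [apply Rabs_triang|]. rewrite Rabs_Ropp. lra.
Qed.

Lemma deriv_on_correct (a b : R) (f : R -> R) (x : R) :
  a < b -> on_itv a b x -> derivable_on a b f ->
  is_deriv_on a b f x (deriv_on a b f x).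
Proof.
intros Hab Hx Hd. destruct (Hd x Hx) as [l Hl].
now rewrite (is_deriv_on_unique Hab Hx Hl).
Qed.

Lemma is_derive_deriv_on (a b : R) (f : R -> R) (x l : R) :
  is_derive f x l -> is_deriv_on a b f x l.
Proof.
rewrite is_derive_spec, is_deriv_on_spec. intros H eps Heps.
destruct (H eps Heps) as [d [Hd0 Hd]]. exists d; split; [assumption|auto].
Qed.

Lemma is_deriv_on_derive (a b : R) (f : R -> R) (x l : R) :
  a < x < b -> is_deriv_on a b f x l -> is_derive f x l.
Proof.
rewrite is_derive_spec, is_deriv_on_spec. intros Hx H eps Heps.
destruct (H eps Heps) as [d [Hd0 Hd]].
exists (Rmin d (Rmin (x - a) (b - x))); split.
- repeat apply Rmin_glb_lt; lra.
- intros t Htx Hlt.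
  assert (Rabs (t - x) < d) by (eapply Rlt_le_trans; [apply Hlt|apply Rmin_l]).
  assert (H2 : Rabs (t - x) < Rmin (x - a) (b - x))
    by (eapply Rlt_le_trans; [apply Hlt|apply Rmin_r]).
  assert (Rabs (t - x) < x - a) by (eapply Rlt_le_trans; [apply H2|apply Rmin_l]).
  assert (Rabs (t - x) < b - x) by (eapply Rlt_le_trans; [apply H2|apply Rmin_r]).
  apply Hd; auto. unfold on_itv. unfold Rabs in *; destruct (Rcase_abs (t - x)); lra.
Qed.

Lemma is_deriv_on_ext (a b : R) (f g : R -> R) (x l : R) :
  on_itv a b x -> (forall t, on_itv a b t -> f t = g t) ->
  is_deriv_on a b f x l -> is_deriv_on a b g x l.
Proof.
rewrite !is_deriv_on_spec. intros Hx Hfg H eps Heps.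
destruct (H eps Heps) as [e [He0 He]]. exists e; split; [assumption|].
intros t Ht; rewrite <- !Hfg by assumption; now apply He.
Qed.

(** Continuation by the constant end values. Projection onto [[a, b]] does not increase distances,
    so continuity on [[a, b]] becomes continuity on the whole line. *)
Definition clamp (a b : R) (f : R -> R) (x : R) : R := f (Rmax a (Rmin b x)).

Lemma clamp_itv (a b x : R) : a <= b -> on_itv a b (Rmax a (Rmin b x)).
Proof.
intros Hab. split; [apply Rmax_l|apply Rmax_lub; [lra|apply Rmin_l]].
Qed.

Lemma clamp_eq (a b : R) (f : R -> R) (x : R) : on_itv a b x -> clamp a b f x = f x.
Proof.
intros [H1 H2]. unfold clamp. rewrite Rmin_right, Rmax_right; auto.
Qed.

Lemma continuous_clamp (a b : R) (f : R -> R) (x : R) :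
  a <= b -> continuous_on (on_itv a b) f -> continuous (clamp a b f) x.
Proof.
rewrite continuous_on_spec, continuous_spec. intros Hab H eps Heps.
destruct (H _ (clamp_itv x Hab) eps Heps) as [d [Hd0 Hd]].
exists d; split; [assumption|]. intros t Ht. apply Hd; [now apply clamp_itv|].
eapply Rle_lt_trans; [|exact Ht].
unfold Rmax, Rmin, Rabs; repeat (destruct (Rle_dec _ _) || destruct (Rcase_abs _)); lra.
Qed.

Lemma continuous_on_of_continuous (a b : R) (f : R -> R) :
  (forall x, on_itv a b x -> continuous f x) -> continuous_on (on_itv a b) f.
Proof.
rewrite continuous_on_spec. intros H x Hx eps Heps.
specialize (H x Hx). rewrite continuous_spec in H.
destruct (H eps Heps) as [d [Hd0 Hd]]. exists d; auto.
Qed.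

Lemma continuous_on_itv_ext (a b : R) (f g : R -> R) :
  (forall x, on_itv a b x -> f x = g x) ->
  continuous_on (on_itv a b) f -> continuous_on (on_itv a b) g.
Proof.
rewrite !continuous_on_spec. intros E H x Hx eps Heps.
destruct (H x Hx eps Heps) as [d [Hd0 Hd]]. exists d; split; [assumption|].
intros t Ht; rewrite <- !E by assumption; now apply Hd.
Qed.

(** * Primitives and the fundamental theorem of calculus *)

Lemma continuous_is_RInt (f : R -> R) (a b : R) :
  (forall x, continuous f x) -> is_RInt f a b (RInt f a b).
Proof.
intros H. apply (RInt_correct (V := R_CompleteNormedModule)).
apply (ex_RInt_continuous (V := R_CompleteNormedModule)). auto.
Qed.

Lemma is_derive_primitive (f : R -> R) (a x : R) :
  (forall x, continuous f x) -> is_derive (fun t => RInt f a t) x (f x).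
Proof.
intros H. apply (is_derive_RInt (V := R_NormedModule)) with a; [|apply H].
exists posreal_one. intros y _. now apply continuous_is_RInt.
Qed.

Lemma constant_on_itv (f : R -> R) (a b : R) :
  a <= b -> (forall x, continuous f x) -> (forall x, a < x < b -> is_derive f x 0) ->
  f b = f a.
Proof.
intros Hab Hc Hd.
destruct (MVT_gen f a b (fun _ => 0)) as [c [_ E]]; rewrite ?Rmin_left, ?Rmax_right by assumption.
- exact Hd.
- intros x _. apply continuity_pt_filterlim, Hc.
- lra.
Qed.

(** Differentiability is asked for only inside the interval, because it may fail at a corner. The
    clamped [F] minus a primitive of the clamped [f] is continuous with zero derivative inside,
    hence constant. *)
Lemma ftc_open (F f : R -> R) (a b : R) :
  a <= b -> continuous_on (on_itv a b) F -> continuous_on (on_itv a b) f ->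
  (forall x, a < x < b -> is_derive F x (f x)) ->
  is_RInt f a b (F b - F a).
Proof.
intros Hab HF Hf Hd.
assert (Cf : forall x, continuous (clamp a b f) x) by (intros; now apply continuous_clamp).
apply is_RInt_ext with (clamp a b f).
{ intros x. rewrite Rmin_left, Rmax_right by assumption. intros Hx.
  apply clamp_eq; unfold on_itv; lra. }
replace (F b - F a) with (RInt (clamp a b f) a b).
2:{ assert (E : clamp a b F b - RInt (clamp a b f) a b = clamp a b F a - RInt (clamp a b f) a a).
    { apply (@constant_on_itv (fun x => clamp a b F x - RInt (clamp a b f) a x)); [assumption| |].
      - intros x. apply (continuous_minus (V := R_NormedModule)).
        + now apply continuous_clamp.
        + apply (ex_derive_continuous (V := R_NormedModule)).
          eexists; now apply is_derive_primitive.
      - intros x Hx. replace 0 with (f x - clamp a b f x)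
          by (rewrite clamp_eq; unfold on_itv; lra).
        apply (is_derive_minus (V := R_NormedModule)).
        + apply is_derive_ext_loc with F; [|now apply Hd].
          apply filter_imp with (fun t => a < t < b).
          * intros t Ht. symmetry; apply clamp_eq; unfold on_itv; lra.
          * apply (open_and _ _ (open_gt a) (open_lt b)); lra.
        + now apply is_derive_primitive. }
    rewrite (RInt_point (V := R_CompleteNormedModule)) in E.
    rewrite !clamp_eq in E by (unfold on_itv; lra). change (@zero _) with 0 in E. lra. }
now apply continuous_is_RInt.
Qed.

Lemma is_derive_continuous (f : R -> R) (x l : R) : is_derive f x l -> continuous f x.
Proof.
intros H. apply (ex_derive_continuous (V := R_NormedModule)). now exists l.
Qed.

(** Two-sided calculus becomes available on [[a, b]] after extension. *)
Lemma C1_extension (a b : R) (f : R -> R) :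
  a < b -> Ck_on 1 a b f ->
  exists F dF : R -> R, (forall x, on_itv a b x -> F x = f x) /\
    (forall x, is_derive F x (dF x)) /\ (forall x, continuous dF x) /\
    (forall x, on_itv a b x -> dF x = deriv_on a b f x).
Proof.
intros Hab (Cf & Df & Cdf).
assert (Hle : a <= b) by lra.
set (g := clamp a b (deriv_on a b f)).
assert (Cg : forall x, continuous g x) by (intros; now apply continuous_clamp).
(* Integrating the clamped derivative continues [f] by its tangent lines at the two ends. *)
exists (fun x => f a + RInt g a x), g. split; [|split; [|split; [exact Cg|]]].
- intros x Hx.
  replace (RInt g a x) with (f x - f a); [lra|symmetry].
  apply (is_RInt_unique (V := R_CompleteNormedModule)).
  destruct Hx as [Hx1 Hx2]. apply ftc_open; auto.
  + rewrite continuous_on_spec in *. intros z Hz eps Heps.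
    destruct (Cf z) with eps as [d [Hd0 Hd]]; auto. unfold on_itv in *; lra.
    exists d; split; auto. intros t Ht; apply Hd; unfold on_itv in *; lra.
  + apply continuous_on_of_continuous; auto.
  + intros z Hz. unfold g. rewrite clamp_eq by (unfold on_itv; lra).
    apply (@is_deriv_on_derive a b); [lra|].
    apply deriv_on_correct; auto. unfold on_itv; lra.
- intros x. replace (g x) with (0 + g x) by ring.
  apply (is_derive_plus (V := R_NormedModule)).
  + apply (is_derive_const (V := R_NormedModule)).
  + now apply is_derive_primitive.
- intros x Hx. now apply clamp_eq.
Qed.

Lemma deriv_on_extension (a b : R) (f F : R -> R) (x l : R) :
  a < b -> (forall t, on_itv a b t -> F t = f t) -> on_itv a b x ->
  is_derive F x l -> is_deriv_on a b f x l.
Proof.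
intros Hab E Hx H. apply is_deriv_on_ext with F; auto. now apply is_derive_deriv_on.
Qed.

(** Converse to the extension lemma: a function is shown to be C^1 on [[a, b]] through two-sided
    derivatives of an extension. *)
Lemma Ck_on1_intro (a b : R) (f F dF : R -> R) :
  a < b -> (forall x, on_itv a b x -> F x = f x) ->
  (forall x, on_itv a b x -> is_derive F x (dF x)) ->
  (forall x, on_itv a b x -> continuous dF x) ->
  Ck_on 1 a b f.
Proof.
intros Hab E D C. split; [|split].
- apply continuous_on_itv_ext with F; auto. apply continuous_on_of_continuous.
  intros x Hx. now apply is_derive_continuous with (dF x), D.
- intros x Hx. exists (dF x). apply deriv_on_extension with F; auto.
- apply continuous_on_itv_ext with dF; [|now apply continuous_on_of_continuous].
  intros x Hx. symmetry. apply is_deriv_on_unique; auto.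
  apply deriv_on_extension with F; auto.
Qed.

(** * Continuity of algebraic expressions *)

Lemma continuous_pow (f : R -> R) (n : nat) (x : R) :
  continuous f x -> continuous (fun t => f t ^ n) x.
Proof.
intros Hf. induction n as [|n IH]; simpl; [apply continuous_const|].
now apply (continuous_mult (K := R_AbsRing) f (fun t => f t ^ n)).
Qed.

Lemma continuous_div (f g : R -> R) (x : R) :
  continuous f x -> continuous g x -> g x <> 0 -> continuous (fun t => f t / g t) x.
Proof.
intros Hf Hg H0. apply (continuous_mult (K := R_AbsRing) f (fun t => / g t)); auto.
now apply continuous_Rinv_comp.
Qed.

Ltac continuity_rec :=
  match goal with
  | |- continuous (fun t => @?f t + @?g t) _ =>
      apply (continuous_plus (V := R_NormedModule) f g); continuity_rec
  | |- continuous (fun t => @?f t - @?g t) _ =>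
      apply (continuous_minus (V := R_NormedModule) f g); continuity_rec
  | |- continuous (fun t => - @?f t) _ =>
      apply (continuous_opp (V := R_NormedModule) f); continuity_rec
  | |- continuous (fun t => @?f t * @?g t) _ =>
      apply (continuous_mult (K := R_AbsRing) f g); continuity_rec
  | |- continuous (fun t => @?f t / @?g t) _ =>
      apply (@continuous_div f g); [continuity_rec|continuity_rec|]
  | |- continuous (fun t => @?f t ^ ?n) _ => apply (@continuous_pow f n); continuity_rec
  | |- continuous (fun _ => ?c) _ => apply continuous_const
  | |- _ => try assumption
  end.

(** * Lagrangians along a curve *)

Definition uncurry3 (f : R -> R -> R -> R) (p : R * R * R) : R :=
  f (fst (fst p)) (snd (fst p)) (snd p).

Lemma open_box (Omega : R * R * R -> Prop) (x y z : R) :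
  open Omega -> Omega (x, y, z) ->
  exists d, 0 < d /\ forall r s t,
    Rabs (r - x) < d -> Rabs (s - y) < d -> Rabs (t - z) < d -> Omega (r, s, t).
Proof.
intros HO Hx. destruct (HO _ Hx) as [d Hd].
exists d; split; [apply cond_pos|]. intros r s t Hr Hs Ht.
apply Hd. repeat split; assumption.
Qed.

Lemma continuous_on_box (Omega : R * R * R -> Prop) (f : R -> R -> R -> R) (x y z eps : R) :
  open Omega -> Omega (x, y, z) -> continuous_on Omega (uncurry3 f) -> 0 < eps ->
  exists d, 0 < d /\ forall r s t,
    Rabs (r - x) < d -> Rabs (s - y) < d -> Rabs (t - z) < d ->
    Omega (r, s, t) /\ Rabs (f r s t - f x y z) < eps.
Proof.
intros HO Hx Hc Heps. destruct (open_box x y z HO Hx) as [d0 [Hd0 B0]].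
specialize (Hc _ Hx). rewrite filterlim_locally in Hc.
destruct (Hc (mkposreal eps Heps)) as [d Hd].
exists (Rmin d0 d); split; [apply Rmin_glb_lt; [lra|apply cond_pos]|].
intros r s t Hr Hs Ht. pose proof (Rmin_l d0 d). pose proof (Rmin_r d0 d).
assert (HOm : Omega (r, s, t)) by (apply B0; lra).
split; [assumption|]. refine (Hd (r, s, t) _ HOm).
split; [split|]; [apply (Rlt_le_trans _ _ d Hr)|apply (Rlt_le_trans _ _ d Hs)|apply (Rlt_le_trans _ _ d Ht)];
  apply Rmin_r.
Qed.

Lemma partial_ext_loc (Omega : R * R * R -> Prop) (f g : R -> R -> R -> R) (x y z : R) :
  open Omega -> (forall x y z, Omega (x, y, z) -> f x y z = g x y z) -> Omega (x, y, z) ->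
  locally x (fun t => f t y z = g t y z) /\
  locally y (fun t => f x t z = g x t z) /\
  locally z (fun t => f x y t = g x y t).
Proof.
intros HO E Hx. destruct (open_box x y z HO Hx) as [d [Hd B]].
assert (Z : forall w, Rabs (w - w) < d) by (intros; rewrite Rminus_diag, Rabs_R0; lra).
repeat split; exists (mkposreal d Hd); intros t Ht; apply E, B; auto.
Qed.

(** [Derive] sees only a neighbourhood of the point, and functions equal on the open set [Omega] are
    equal near each of its points. Hence their partial derivatives agree on [Omega] and the
    induction goes through. *)
Lemma Ck3_ext (k : nat) (Omega : R * R * R -> Prop) (f g : R -> R -> R -> R) :
  open Omega -> (forall x y z, Omega (x, y, z) -> f x y z = g x y z) ->
  Ck3 k Omega f -> Ck3 k Omega g.
Proof.
intros HO. revert f g.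
assert (HC : forall f g : R -> R -> R -> R,
  (forall x y z, Omega (x, y, z) -> f x y z = g x y z) ->
  continuous_on Omega (uncurry3 f) -> continuous_on Omega (uncurry3 g)).
{ intros f g E C [[x y] z] Hx.
  refine (eq_ind (uncurry3 f (x, y, z)) (fun l => filterlim (uncurry3 g) _ (locally l)) _ _ (E x y z Hx)).
  apply filterlim_within_ext with (uncurry3 f); [|now apply C].
  intros [[r s] t] Hr. now apply E. }
induction k as [|k IH]; intros f g E.
- now apply HC.
- intros (C & D & Kx & Ky & Kz). split; [now apply (HC f)|].
  split; [|split; [|split]].
  + intros x y z Hx. destruct (D x y z Hx) as (D1 & D2 & D3).
    destruct (partial_ext_loc f g x y z HO E Hx) as (L1 & L2 & L3).
    split; [|split]; (eapply ex_derive_ext_loc; [|eassumption]; assumption).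
  + apply (IH (d_x f)); [|assumption]. intros x y z Hx.
    destruct (partial_ext_loc f g x y z HO E Hx) as (L1 & L2 & L3). now apply Derive_ext_loc.
  + apply (IH (d_y f)); [|assumption]. intros x y z Hx.
    destruct (partial_ext_loc f g x y z HO E Hx) as (L1 & L2 & L3). now apply Derive_ext_loc.
  + apply (IH (d_z f)); [|assumption]. intros x y z Hx.
    destruct (partial_ext_loc f g x y z HO E Hx) as (L1 & L2 & L3). now apply Derive_ext_loc.
Qed.

(** The partials of the combination match the combination of the partials where these exist, that
    is, on [Omega]; [Ck3_ext] transfers smoothness across this restricted equality. *)
Lemma Ck3_lagrangian (k : nat) (Omega : R * R * R -> Prop) (F G : R -> R -> R -> R)
  (lambda : R) :
  open Omega -> Ck3 k Omega F -> Ck3 k Omega G -> Ck3 k Omega (lagrangian F G lambda).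
Proof.
intros HO. revert F G.
assert (HC : forall F G : R -> R -> R -> R,
  continuous_on Omega (uncurry3 F) -> continuous_on Omega (uncurry3 G) ->
  continuous_on Omega (uncurry3 (lagrangian F G lambda))).
{ intros F G CF CG p Hp.
  refine (filterlim_comp_2 (uncurry3 F) (fun q => lambda * uncurry3 G q) Rplus
    (G := locally (uncurry3 F p)) (H := locally (lambda * uncurry3 G p)) _ _ _).
  - exact (CF p Hp).
  - eapply filterlim_comp; [exact (CG p Hp)|].
    apply (filterlim_scal_r (V := R_NormedModule)).
  - apply (filterlim_plus (V := R_NormedModule)). }
induction k as [|k IH]; intros F G.
- apply HC.
- intros (CF & DF & Fx & Fy & Fz) (CG & DG & Gx & Gy & Gz).
  split; [now apply HC|].
  assert (S : forall f g : R -> R, forall x, ex_derive f x -> ex_derive g x ->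
    ex_derive (fun t => f t + lambda * g t) x /\
    Derive f x + lambda * Derive g x = Derive (fun t => f t + lambda * g t) x).
  { intros f g x Df Dg.
    assert (Dl : ex_derive (fun t => lambda * g t) x) by now apply ex_derive_scal.
    split.
    - now apply (ex_derive_plus (V := R_NormedModule)).
    - rewrite Derive_plus, Derive_scal by assumption. reflexivity. }
  split; [|split; [|split]].
  + intros x y z Hx. destruct (DF x y z Hx) as (F1 & F2 & F3).
    destruct (DG x y z Hx) as (G1 & G2 & G3).
    split; [|split]; now apply S.
  + apply Ck3_ext with (lagrangian (d_x F) (d_x G) lambda); auto.
    intros x y z Hx. apply (S (fun t => F t y z) (fun t => G t y z));
      [apply (DF x y z Hx)|apply (DG x y z Hx)].
  + apply Ck3_ext with (lagrangian (d_y F) (d_y G) lambda); auto.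
    intros x y z Hx. apply (S (fun t => F x t z) (fun t => G x t z));
      [apply (DF x y z Hx)|apply (DG x y z Hx)].
  + apply Ck3_ext with (lagrangian (d_z F) (d_z G) lambda); auto.
    intros x y z Hx. apply (S (fun t => F x y t) (fun t => G x y t));
      [apply (DF x y z Hx)|apply (DG x y z Hx)].
Qed.

Lemma mean_value_estimate (f df : R -> R) (r s c eps : R) :
  (forall t, Rmin r s <= t <= Rmax r s -> is_derive f t (df t) /\ Rabs (df t - c) <= eps) ->
  Rabs (f s - f r - c * (s - r)) <= eps * Rabs (s - r).
Proof.
intros H. destruct (MVT_gen f r s df) as [t [Ht E]].
- intros x Hx. apply H; lra.
- intros x Hx. apply continuity_pt_filterlim. eapply is_derive_continuous, H, Hx.
- rewrite E. replace (df t * (s - r) - c * (s - r)) with ((df t - c) * (s - r)) by ring.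
  rewrite Rabs_mult. apply Rmult_le_compat_r; [apply Rabs_pos|now apply H].
Qed.

Lemma Rabs_between (r s t d : R) :
  Rabs (s - r) < d -> Rmin r s <= t <= Rmax r s -> Rabs (t - r) < d.
Proof.
unfold Rmin, Rmax, Rabs. repeat (destruct (Rle_dec _ _) || destruct (Rcase_abs _)); lra.
Qed.

(** The increment of [f] is split into three moves parallel to the axes. The mean value theorem
    treats each move, and continuity of the partials makes the remainders small. *)
Lemma Ck3_chain_rule (Omega : R * R * R -> Prop) (f : R -> R -> R -> R)
  (Y Z : R -> R) (x dY dZ : R) :
  open Omega -> Ck3 1 Omega f -> Omega (x, Y x, Z x) ->
  is_derive Y x dY -> is_derive Z x dZ ->
  is_derive (fun t => f t (Y t) (Z t)) x
    (d_x f x (Y x) (Z x) + d_y f x (Y x) (Z x) * dY + d_z f x (Y x) (Z x) * dZ).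
Proof.
intros HO (_ & D & Kx & Ky & Kz) Hx HY HZ.
set (fx := d_x f x (Y x) (Z x)). set (fy := d_y f x (Y x) (Z x)). set (fz := d_z f x (Y x) (Z x)).
rewrite is_derive_spec. intros eps Heps.
pose proof (Rabs_pos dY). pose proof (Rabs_pos dZ).
pose proof (Rabs_pos fy). pose proof (Rabs_pos fz).
(* The three remainders will add up to at most [e1 * M * |t - x|], that is, [eps / 2] times
   [|t - x|]. [N] weighs the errors of the difference quotients of [Y] and [Z]; capping [e2] at 1
   keeps these quotients within 1 of [dY] and [dZ]. *)
set (M := 3 + Rabs dY + Rabs dZ). set (N := 1 + Rabs fy + Rabs fz).
assert (He1 : 0 < eps / (2 * M)) by (unfold M; apply Rdiv_lt_0_compat; lra).
assert (He2 : 0 < Rmin 1 (eps / (2 * N)))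
  by (unfold N; apply Rmin_glb_lt; [lra|apply Rdiv_lt_0_compat; lra]).
set (e1 := eps / (2 * M)) in *. set (e2 := Rmin 1 (eps / (2 * N))) in *.
destruct (continuous_on_box x (Y x) (Z x) HO Hx Kx He1) as [d1 [Hd1 B1]].
destruct (continuous_on_box x (Y x) (Z x) HO Hx Ky He1) as [d2 [Hd2 B2]].
destruct (continuous_on_box x (Y x) (Z x) HO Hx Kz He1) as [d3 [Hd3 B3]].
pose proof (is_derive_continuous HY) as CY. pose proof (is_derive_continuous HZ) as CZ.
rewrite continuous_spec in CY, CZ.
set (d := Rmin d1 (Rmin d2 d3)).
assert (Hd : 0 < d) by (repeat apply Rmin_glb_lt; lra).
assert (d <= d1) by apply Rmin_l.
assert (d <= d2) by (eapply Rle_trans; [apply Rmin_r|apply Rmin_l]).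
assert (d <= d3) by (eapply Rle_trans; [apply Rmin_r|apply Rmin_r]).
destruct (CY d Hd) as [d4 [Hd4 B4]]. destruct (CZ d Hd) as [d5 [Hd5 B5]].
rewrite is_derive_spec in HY, HZ.
destruct (HY _ He2) as [d6 [Hd6 B6]]. destruct (HZ _ He2) as [d7 [Hd7 B7]].
exists (Rmin d (Rmin (Rmin d4 d5) (Rmin d6 d7))); split; [repeat apply Rmin_glb_lt; lra|].
intros t Htx Ht.
assert (T0 : Rabs (t - x) < d) by (eapply Rlt_le_trans; [apply Ht|apply Rmin_l]).
assert (T1 : Rabs (t - x) < Rmin (Rmin d4 d5) (Rmin d6 d7))
  by (eapply Rlt_le_trans; [apply Ht|apply Rmin_r]).
assert (T45 : Rabs (t - x) < Rmin d4 d5) by (eapply Rlt_le_trans; [apply T1|apply Rmin_l]).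
assert (T67 : Rabs (t - x) < Rmin d6 d7) by (eapply Rlt_le_trans; [apply T1|apply Rmin_r]).
assert (T4 : Rabs (t - x) < d4) by (eapply Rlt_le_trans; [apply T45|apply Rmin_l]).
assert (T5 : Rabs (t - x) < d5) by (eapply Rlt_le_trans; [apply T45|apply Rmin_r]).
assert (T6 : Rabs (t - x) < d6) by (eapply Rlt_le_trans; [apply T67|apply Rmin_l]).
assert (T7 : Rabs (t - x) < d7) by (eapply Rlt_le_trans; [apply T67|apply Rmin_r]).
specialize (B4 t T4). specialize (B5 t T5). specialize (B6 t Htx T6). specialize (B7 t Htx T7).
assert (Z0 : forall w, Rabs (w - w) < d) by (intros; rewrite Rminus_diag, Rabs_R0; lra).
assert (E1 : Rabs (f t (Y t) (Z t) - f x (Y t) (Z t) - fx * (t - x)) <= e1 * Rabs (t - x)).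
{ apply (@mean_value_estimate (fun r => f r (Y t) (Z t)) (fun r => d_x f r (Y t) (Z t))).
  intros r Hr. pose proof (@Rabs_between _ _ _ _ T0 Hr).
  destruct (B1 r (Y t) (Z t)) as [Om Hlt]; try lra.
  split; [|left; exact Hlt]. apply Derive_correct. apply (D _ _ _ Om). }
assert (E2 : Rabs (f x (Y t) (Z t) - f x (Y x) (Z t) - fy * (Y t - Y x)) <= e1 * Rabs (Y t - Y x)).
{ apply (@mean_value_estimate (fun r => f x r (Z t)) (fun r => d_y f x r (Z t))).
  intros r Hr. pose proof (@Rabs_between _ _ _ _ B4 Hr). pose proof (Z0 x).
  destruct (B2 x r (Z t)) as [Om Hlt]; try lra.
  split; [|left; exact Hlt]. apply Derive_correct. apply (D _ _ _ Om). }
assert (E3 : Rabs (f x (Y x) (Z t) - f x (Y x) (Z x) - fz * (Z t - Z x)) <= e1 * Rabs (Z t - Z x)).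
{ apply (@mean_value_estimate (fun r => f x (Y x) r) (fun r => d_z f x (Y x) r)).
  intros r Hr. pose proof (@Rabs_between _ _ _ _ B5 Hr). pose proof (Z0 x). pose proof (Z0 (Y x)).
  destruct (B3 x (Y x) r) as [Om Hlt]; try lra.
  split; [|left; exact Hlt]. apply Derive_correct. apply (D _ _ _ Om). }
set (qy := (Y t - Y x) / (t - x)) in *. set (qz := (Z t - Z x) / (t - x)) in *.
assert (EY : Y t - Y x = qy * (t - x)) by (unfold qy; field; lra).
assert (EZ : Z t - Z x = qz * (t - x)) by (unfold qz; field; lra).
rewrite EY, Rabs_mult in E2. rewrite EZ, Rabs_mult in E3.
assert (Hq : forall q dq, Rabs (q - dq) < e2 -> Rabs q <= Rabs dq + 1).
{ intros q dq Hlt. replace q with ((q - dq) + dq) by ring.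
  eapply Rle_trans; [apply Rabs_triang|]. assert (e2 <= 1) by apply Rmin_l. lra. }
pose proof (Hq _ _ B6) as Qy. pose proof (Hq _ _ B7) as Qz.
assert (Hpos : 0 < Rabs (t - x)) by (apply Rabs_pos_lt; lra).
set (A := Rabs (t - x)) in *.
set (r1 := f t (Y t) (Z t) - f x (Y t) (Z t) - fx * (t - x)) in *.
set (r2 := f x (Y t) (Z t) - f x (Y x) (Z t) - fy * (qy * (t - x))) in *.
set (r3 := f x (Y x) (Z t) - f x (Y x) (Z x) - fz * (qz * (t - x))) in *.
replace ((f t (Y t) (Z t) - f x (Y x) (Z x)) / (t - x) - (fx + fy * dY + fz * dZ))
  with ((r1 + r2 + r3) / (t - x) + (fy * (qy - dY) + fz * (qz - dZ)))
  by (unfold r1, r2, r3; field; lra).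
eapply Rle_lt_trans; [apply Rabs_triang|].
assert (F1 : Rabs ((r1 + r2 + r3) / (t - x)) <= eps / 2).
{ rewrite Rabs_div by lra. fold A. apply Rle_div_l; [lra|].
  apply Rle_trans with (Rabs r1 + Rabs r2 + Rabs r3).
  { eapply Rle_trans; [apply Rabs_triang|]. apply Rplus_le_compat_r, Rabs_triang. }
  apply Rle_trans with (e1 * M * A).
  2:{ unfold e1. right. field. unfold M; lra. }
  unfold M. assert (e1 * (Rabs qy * A) <= e1 * ((Rabs dY + 1) * A)).
  { apply Rmult_le_compat_l; [lra|]. apply Rmult_le_compat_r; lra. }
  assert (e1 * (Rabs qz * A) <= e1 * ((Rabs dZ + 1) * A)).
  { apply Rmult_le_compat_l; [lra|]. apply Rmult_le_compat_r; lra. }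
  lra. }
assert (F2 : Rabs (fy * (qy - dY) + fz * (qz - dZ)) < eps / 2).
{ eapply Rle_lt_trans; [apply Rabs_triang|]. rewrite !Rabs_mult.
  assert (He2N : e2 * N <= eps / 2).
  { apply Rle_trans with (eps / (2 * N) * N).
    - apply Rmult_le_compat_r; [unfold N; lra|apply Rmin_r].
    - right. field. unfold N; lra. }
  assert (Rabs fy * Rabs (qy - dY) <= Rabs fy * e2) by (apply Rmult_le_compat_l; lra).
  assert (Rabs fz * Rabs (qz - dZ) <= Rabs fz * e2) by (apply Rmult_le_compat_l; lra).
  unfold N in He2N. lra. }
lra.
Qed.

Lemma continuous_curve (Omega : R * R * R -> Prop) (f : R -> R -> R -> R)
  (Y Z : R -> R) (x : R) :
  open Omega -> continuous_on Omega (uncurry3 f) -> Omega (x, Y x, Z x) ->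
  continuous Y x -> continuous Z x -> continuous (fun t => f t (Y t) (Z t)) x.
Proof.
intros HO Cf Hx CY CZ. rewrite continuous_spec in *. intros eps Heps.
destruct (continuous_on_box x (Y x) (Z x) HO Hx Cf Heps) as [d [Hd B]].
destruct (CY d Hd) as [d1 [Hd1 B1]]. destruct (CZ d Hd) as [d2 [Hd2 B2]].
exists (Rmin d (Rmin d1 d2)); split; [repeat apply Rmin_glb_lt; lra|].
intros t Ht. pose proof (Rmin_l d (Rmin d1 d2)). pose proof (Rmin_r d (Rmin d1 d2)).
pose proof (Rmin_l d1 d2). pose proof (Rmin_r d1 d2).
apply B; [lra|apply B1; lra|apply B2; lra].
Qed.

(** * Piecewise smooth functions *)

(** A form of piecewise smoothness without nodes, so that integrals are handled by induction on
    concatenation. On a piece, [dh] has to agree with a continuous [g] only inside, which leaves its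
    values at the corners free. *)
Inductive piecewise_C1 (h dh : R -> R) : R -> R -> Prop :=
| piecewise_C1_piece (p q : R) (g : R -> R) :
    p <= q -> (forall x, continuous g x) ->
    (forall x, p < x < q -> is_derive h x (dh x) /\ dh x = g x) ->
    piecewise_C1 h dh p q
| piecewise_C1_concat (p q r : R) :
    piecewise_C1 h dh p q -> piecewise_C1 h dh q r -> piecewise_C1 h dh p r.

Lemma piecewise_C1_le (h dh : R -> R) (p q : R) : piecewise_C1 h dh p q -> p <= q.
Proof. induction 1; lra. Qed.

Lemma piecewise_C1_sub (h dh : R -> R) (p q c d : R) :
  piecewise_C1 h dh p q -> p <= c -> c <= d -> d <= q -> piecewise_C1 h dh c d.
Proof.
intros H. revert c d. induction H as [p q g Hpq Cg D|p q r H1 IH1 H2 IH2]; intros c d Hc Hcd Hd.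
- apply piecewise_C1_piece with g; auto. intros x Hx; apply D; lra.
- apply piecewise_C1_le in H1, H2.
  destruct (Rle_dec d q); [apply IH1; lra|].
  destruct (Rle_dec q c); [apply IH2; lra|].
  apply piecewise_C1_concat with q; [apply IH1|apply IH2]; lra.
Qed.

(** Values at corners are irrelevant, so no derivative of [F] is needed there. *)
Lemma piecewise_ftc (h dh F A B C : R -> R) (c d : R) :
  piecewise_C1 h dh c d ->
  (forall x, c <= x <= d -> continuous F x /\ continuous A x /\ continuous B x /\ continuous C x) ->
  (forall x, c < x < d -> is_derive h x (dh x) ->
     is_derive F x (A x * dh x ^ 2 + B x * dh x + C x)) ->
  is_RInt (fun x => A x * dh x ^ 2 + B x * dh x + C x) c d (F d - F c).
Proof.
induction 1 as [p q g Hpq Cg D|p q r H1 IH1 H2 IH2]; intros Hc HF.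
- apply is_RInt_ext with (fun x => A x * g x ^ 2 + B x * g x + C x).
  { intros x. rewrite Rmin_left, Rmax_right by assumption. intros Hx.
    now destruct (D x Hx) as [_ ->]. }
  apply ftc_open; [assumption| | |].
  + apply continuous_on_of_continuous. intros x Hx; exact (proj1 (Hc x Hx)).
  + apply continuous_on_of_continuous. intros x Hx. destruct (Hc x Hx) as (_ & CA & CB & CC).
    pose proof (Cg x). continuity_rec.
  + intros x Hx. destruct (D x Hx) as [Dx Ex]. rewrite <- Ex. now apply HF.
- apply piecewise_C1_le in H1, H2.
  replace (F r - F p) with (plus (F q - F p) (F r - F q)) by (unfold plus; simpl; ring).
  apply (is_RInt_Chasles (V := R_NormedModule)) with q.
  + apply IH1; intros; [apply Hc|apply HF]; auto; lra.
  + apply IH2; intros; [apply Hc|apply HF]; auto; lra.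
Qed.

Lemma piecewise_ex_RInt (h dh A B C : R -> R) (c d : R) :
  piecewise_C1 h dh c d ->
  (forall x, c <= x <= d -> continuous A x /\ continuous B x /\ continuous C x) ->
  ex_RInt (fun x => A x * dh x ^ 2 + B x * dh x + C x) c d.
Proof.
induction 1 as [p q g Hpq Cg D|p q r H1 IH1 H2 IH2]; intros Hc.
- apply ex_RInt_ext with (fun x => A x * g x ^ 2 + B x * g x + C x).
  { intros x. rewrite Rmin_left, Rmax_right by assumption. intros Hx.
    now destruct (D x Hx) as [_ ->]. }
  apply (ex_RInt_continuous (V := R_CompleteNormedModule)).
  intros x. rewrite Rmin_left, Rmax_right by assumption. intros Hx.
  destruct (Hc x Hx) as (CA & CB & CC).
  pose proof (Cg x). continuity_rec.
- apply piecewise_C1_le in H1, H2.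
  apply (ex_RInt_Chasles (V := R_NormedModule)) with q.
  + apply IH1; intros; apply Hc; lra.
  + apply IH2; intros; apply Hc; lra.
Qed.

Lemma piecewise_smooth_C1 (a b : R) (h : R -> R) :
  a < b -> piecewise_smooth a b h ->
  piecewise_C1 (clamp a b h) (deriv_on a b h) a b.
Proof.
intros Hab (Ch & n & s & S0 & Sn & Hs & HC).
(* The nodes increase, so every piece lies in [[a, b]]. *)
assert (Hinc : forall j i, (i + j <= n)%nat -> s i <= s (i + j)%nat).
{ induction j as [|j IH]; intros i Hi; [rewrite Nat.add_0_r; lra|].
  rewrite Nat.add_succ_r. assert (s i <= s (i + j)%nat) by (apply IH; lia).
  assert (s (i + j)%nat < s (S (i + j))) by (apply Hs; lia). lra. }
assert (Hpc : forall i, (i < n)%nat ->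
  piecewise_C1 (clamp a b h) (deriv_on a b h) (s i) (s (S i))).
{ intros i Hi. specialize (Hs i Hi). destruct (HC i Hi) as (_ & D & Cd).
  assert (Ha : a <= s i) by (rewrite <- S0; apply (Hinc i O); lia).
  assert (Hb : s (S i) <= b).
  { rewrite <- Sn. replace n with (S i + (n - S i))%nat by lia. apply Hinc; lia. }
  apply piecewise_C1_piece with (clamp (s i) (s (S i)) (deriv_on (s i) (s (S i)) h)).
  - lra.
  - intros x; apply continuous_clamp; [lra|assumption].
  - intros x Hx.
    assert (Dx : is_derive h x (deriv_on (s i) (s (S i)) h x)).
    { apply is_deriv_on_derive with (s i) (s (S i)); auto.
      apply deriv_on_correct; auto. unfold on_itv; lra. }
    (* Inside a piece the derivative is two-sided, so it is the same relative to the piece and to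
       [[a, b]]. *)
    assert (E : deriv_on a b h x = deriv_on (s i) (s (S i)) h x).
    { apply is_deriv_on_unique; [assumption|unfold on_itv; lra|].
      now apply is_derive_deriv_on. }
    rewrite clamp_eq by (unfold on_itv; lra). split; [|exact E]. rewrite E.
    apply is_derive_ext_loc with h; [|exact Dx].
    apply filter_imp with (fun t => s i < t < s (S i)).
    + intros t Ht. symmetry; apply clamp_eq. unfold on_itv; lra.
    + apply (open_and _ _ (open_gt (s i)) (open_lt (s (S i)))); lra. }
rewrite <- S0, <- Sn.
assert (Hall : forall k, (k <= n)%nat ->
  piecewise_C1 (clamp a b h) (deriv_on a b h) (s O) (s k)).
{ induction k as [|k IH]; intros Hk.
  - apply piecewise_C1_piece with (fun _ => 0); [lra|intros; apply continuous_const|].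
    intros; lra.
  - apply piecewise_C1_concat with (s k); [apply IH; lia|apply Hpc; lia]. }
(* The rewriting also turned [a] and [b] into nodes inside [clamp] and [deriv_on]; they are restored
   there. *)
replace (piecewise_C1 (clamp (s O) (s n) h) (deriv_on (s O) (s n) h) (s O) (s n))
  with (piecewise_C1 (clamp a b h) (deriv_on a b h) (s O) (s n)) by now rewrite S0, Sn.
now apply Hall.
Qed.

(** The pointwise bound makes [t^2 f + 2 t g + k] nonnegative for every real [t], so the polynomial
    [I1 t^2 + 2 I2 t + I3] is never negative. In this form no square roots need to be integrated. *)
Lemma RInt_cauchy_schwarz (f g k : R -> R) (c d I1 I2 I3 : R) :
  c <= d -> is_RInt f c d I1 -> is_RInt g c d I2 -> is_RInt k c d I3 ->
  (forall x, c < x < d -> 0 <= f x /\ 0 <= k x /\ g x ^ 2 <= f x * k x) ->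
  I2 ^ 2 <= I1 * I3.
Proof.
intros Hcd H1 H2 H3 H.
assert (Hpoly : forall t, 0 <= I1 * t ^ 2 + 2 * t * I2 + I3).
{ intros t.
  apply (@is_RInt_ge_0 (fun x => t ^ 2 * f x + 2 * t * g x + k x) c d); [assumption| |].
  - replace (I1 * t ^ 2 + 2 * t * I2 + I3) with
      (plus (plus (scal (t ^ 2) I1) (scal (2 * t) I2)) I3)
      by (unfold plus, scal; simpl; unfold mult; simpl; ring).
    apply (is_RInt_plus (V := R_NormedModule)); [|assumption].
    apply (is_RInt_plus (V := R_NormedModule) (fun x => t ^ 2 * f x) (fun x => 2 * t * g x));
      now apply (is_RInt_scal (V := R_NormedModule)).
  - intros x Hx. destruct (H x Hx) as (Hf & Hk & Hg).
    destruct (Req_dec (f x) 0) as [E|E].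
    + rewrite E, Rmult_0_l in Hg. assert (g x = 0) by nra. rewrite H0, E. lra.
    + apply Rmult_le_reg_l with (f x); [lra|].
      replace (f x * (t ^ 2 * f x + 2 * t * g x + k x))
        with ((t * f x + g x) ^ 2 + (f x * k x - g x ^ 2)) by ring.
      pose proof (pow2_ge_0 (t * f x + g x)). lra. }
assert (0 <= I1) by (apply (is_RInt_ge_0 f c d); auto; intros; now apply H).
destruct (Req_dec I1 0) as [E|E].
- assert (I2 = 0); [|subst; nra].
  destruct (Req_dec I2 0) as [|E2]; [assumption|exfalso].
  (* With [I1 = 0] the polynomial is affine in [t], and at this [t] it would equal -1. *)
  specialize (Hpoly (- (I3 + 1) / (2 * I2))). rewrite E in Hpoly.
  replace (0 * (- (I3 + 1) / (2 * I2)) ^ 2 + 2 * (- (I3 + 1) / (2 * I2)) * I2 + I3)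
    with (-1) in Hpoly by (field; assumption). lra.
(* The minimum of the quadratic polynomial. *)
- specialize (Hpoly (- I2 / I1)).
  replace (I1 * (- I2 / I1) ^ 2 + 2 * (- I2 / I1) * I2 + I3)
    with ((I1 * I3 - I2 ^ 2) / I1) in Hpoly by (field; assumption).
  assert (0 <= (I1 * I3 - I2 ^ 2) / I1 * I1) by (apply Rmult_le_pos; lra).
  replace ((I1 * I3 - I2 ^ 2) / I1 * I1) with (I1 * I3 - I2 ^ 2) in H1 by (field; assumption).
  match goal with K : 0 <= _ / _ * _ |- _ =>
    replace ((I1 * I3 - I2 ^ 2) / I1 * I1) with (I1 * I3 - I2 ^ 2) in K by (field; assumption) end.
  lra.
Qed.

(** * The constrained quadratic functional *)

Lemma is_derive_Rconst (c x : R) : is_derive (fun _ => c) x 0.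
Proof. apply (is_derive_const (V := R_NormedModule)). Qed.

Lemma is_derive_Rplus (f g : R -> R) (x df dg : R) :
  is_derive f x df -> is_derive g x dg -> is_derive (fun t => f t + g t) x (df + dg).
Proof. apply (is_derive_plus (V := R_NormedModule)). Qed.

Lemma is_derive_Rminus (f g : R -> R) (x df dg : R) :
  is_derive f x df -> is_derive g x dg -> is_derive (fun t => f t - g t) x (df - dg).
Proof. apply (is_derive_minus (V := R_NormedModule)). Qed.

Lemma is_derive_Rmult (f g : R -> R) (x df dg : R) :
  is_derive f x df -> is_derive g x dg ->
  is_derive (fun t => f t * g t) x (df * g x + f x * dg).
Proof.
intros Hf Hg. apply (is_derive_mult f g); auto. intros; apply Rmult_comm.
Qed.

Lemma is_derive_Rdiv (f g : R -> R) (x df dg : R) :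
  is_derive f x df -> is_derive g x dg -> g x <> 0 ->
  is_derive (fun t => f t / g t) x ((df * g x - f x * dg) / g x ^ 2).
Proof. intros Hf Hg H0. now apply is_derive_div. Qed.

Lemma is_derive_square (f : R -> R) (x df : R) :
  is_derive f x df -> is_derive (fun t => f t ^ 2) x (2 * f x * df).
Proof.
intros Hf. replace (2 * f x * df) with (INR 2 * df * f x ^ Init.Nat.pred 2) by (simpl; ring).
now apply is_derive_pow.
Qed.

Lemma is_derive_eq (f : R -> R) (x l l' : R) : is_derive f x l -> l = l' -> is_derive f x l'.
Proof. now intros H <-. Qed.

(** The equation may be typed over the carrier of an algebraic structure; [field] needs to see
    [R]. *)
Ltac real_field :=
  lazymatch goal with |- @eq _ ?x ?y => change (@eq R x y) end; field.

(** Meant to follow [is_derive_eq]: the derivative is assembled as an unknown, with leaves taken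
    from the context, and is compared with the wanted value afterwards by algebra. *)
Ltac derive_rec :=
  match goal with
  | |- is_derive (fun t => @?f t + @?g t) _ _ =>
      eapply (@is_derive_Rplus f g); derive_rec
  | |- is_derive (fun t => @?f t - @?g t) _ _ =>
      eapply (@is_derive_Rminus f g); derive_rec
  | |- is_derive (fun t => @?f t * @?g t) _ _ =>
      eapply (@is_derive_Rmult f g); derive_rec
  | |- is_derive (fun t => @?f t / @?g t) _ _ =>
      eapply (@is_derive_Rdiv f g); [derive_rec|derive_rec|]
  | |- is_derive (fun t => @?f t ^ 2) _ _ =>
      eapply (@is_derive_square f); derive_rec
  | |- is_derive (fun _ => ?c) _ _ => apply (is_derive_Rconst c)
  | |- _ => try eassumption
  end.

Lemma constant_on_itv_closed (f : R -> R) (a b x : R) :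
  (forall x, on_itv a b x -> is_derive f x 0) -> on_itv a b x -> f x = f a.
Proof.
intros D Hx. unfold on_itv in *.
destruct (MVT_gen f a x (fun _ => 0)) as [c [_ E]]; [| |lra];
  intros z; rewrite Rmin_left, Rmax_right by lra; intros Hz.
- apply D; lra.
- apply continuity_pt_filterlim. apply is_derive_continuous with 0, D; lra.
Qed.

Lemma nonzero_near (f : R -> R) (x : R) :
  continuous f x -> f x <> 0 ->
  exists d, 0 < d /\ forall t, Rabs (t - x) < d -> f t <> 0.
Proof.
rewrite continuous_spec. intros C H0.
destruct (C (Rabs (f x)) (Rabs_pos_lt _ H0)) as [d [Hd H]].
exists d; split; [assumption|]. intros t Ht E. specialize (H t Ht).
rewrite E, Rminus_0_l, Rabs_Ropp in H. lra.
Qed.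

(** The two Jacobi fields [(u, m)] (multiplier 0) and [(v, n)] (multiplier 1)
    span the solutions of the Euler equation of the constrained quadratic
    functional that are free at [a]; [p = P u'] and [q = P v'] are their momenta. *)
Record jacobi_fields (a b : R) (P Q T u p v q m n : R -> R) : Prop := {
  jf_P : forall x, continuous P x;
  jf_Q : forall x, continuous Q x;
  jf_T : forall x, continuous T x;
  jf_pos : forall x, 0 < P x;
  jf_u : forall x, on_itv a b x -> is_derive u x (p x / P x);
  jf_p : forall x, on_itv a b x -> is_derive p x (Q x * u x);
  jf_v : forall x, on_itv a b x -> is_derive v x (q x / P x);
  jf_q : forall x, on_itv a b x -> is_derive q x (Q x * v x - T x);
  jf_m : forall x, on_itv a b x -> is_derive m x (u x * T x);
  jf_n : forall x, on_itv a b x -> is_derive n x (v x * T x);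
  jf_pa : p a = 0;
  jf_qa : q a = 0;
  jf_ma : m a = 0;
  jf_na : n a = 0;
  jf_ua : u a <> 0
}.

(** Serves to prove [u a <> 0]: if value and momentum both vanished at [a], the solution [u] would
    be trivial. *)
Lemma homogeneous_uniqueness (a b : R) (P Q u p : R -> R) (x : R) :
  (forall x, continuous P x) -> (forall x, continuous Q x) -> (forall x, 0 < P x) ->
  (forall x, on_itv a b x -> is_derive u x (p x / P x)) ->
  (forall x, on_itv a b x -> is_derive p x (Q x * u x)) ->
  u a = 0 -> p a = 0 -> on_itv a b x -> u x = 0.
Proof.
intros CP CQ HP Du Dp Ua Pa Hx.
set (r := fun t => Rabs (1 / P t + Q t)).
assert (Cr : forall t, continuous r t).
{ intros t. apply (continuous_comp (fun t => 1 / P t + Q t) Rabs); [|apply continuous_Rabs].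
  pose proof (CP t). pose proof (CQ t). continuity_rec. pose proof (HP t); lra. }
(* Gronwall for the energy [u^2 + p^2], whose derivative is at most [r] times itself *)
set (W := fun t => exp (- RInt r a t)).
assert (DW : forall t, is_derive W t (- r t * W t)).
{ intros t. unfold W. apply (is_derive_comp exp (fun t => - RInt r a t)).
  - apply is_derive_exp.
  - apply (is_derive_opp (V := R_NormedModule)). now apply is_derive_primitive. }
set (dg := fun t => (2 * u t * (p t / P t) + 2 * p t * (Q t * u t)) * W t
  + (u t ^ 2 + p t ^ 2) * (- r t * W t)).
assert (Dg : forall t, on_itv a b t -> is_derive (fun t => (u t ^ 2 + p t ^ 2) * W t) t (dg t)).
{ intros t Ht. pose proof (Du t Ht). pose proof (Dp t Ht). pose proof (DW t).
  eapply is_derive_eq; [derive_rec|reflexivity]. }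
unfold on_itv in *.
destruct (MVT_gen (fun t => (u t ^ 2 + p t ^ 2) * W t) a x dg) as [c [Hc E]].
1,2: intros z; rewrite Rmin_left, Rmax_right by lra; intros Hz.
- apply Dg; lra.
- apply continuity_pt_filterlim. assert (Hz' : a <= z <= b) by lra.
  exact (is_derive_continuous (Dg z Hz')).
- rewrite Ua, Pa in E.
  (* [2 |u p| <= u^2 + p^2] bounds the growth rate of the energy by [r], which the weight [W]
     compensates. Starting from 0, the weighted energy cannot become positive. *)
  assert (dg c <= 0).
  { unfold dg. assert (0 < W c) by apply exp_pos.
    assert (2 * u c * (p c / P c) + 2 * p c * (Q c * u c) <= r c * (u c ^ 2 + p c ^ 2)).
    { replace (2 * u c * (p c / P c) + 2 * p c * (Q c * u c))
        with ((1 / P c + Q c) * (2 * (u c * p c))) by (field; pose proof (HP c); lra).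
      eapply Rle_trans; [apply Rle_abs|]. rewrite Rabs_mult.
      apply Rmult_le_compat_l; [apply Rabs_pos|]. apply Rabs_le.
      pose proof (pow2_ge_0 (u c - p c)). pose proof (pow2_ge_0 (u c + p c)). nra. }
    nra. }
  assert (0 < W x) by apply exp_pos.
  assert (dg c * (x - a) <= 0) by nra.
  assert ((u x ^ 2 + p x ^ 2) * W x <= 0) by nra.
  assert (u x ^ 2 + p x ^ 2 <= 0).
  { apply Rmult_le_reg_r with (W x); [assumption|]. lra. }
  nra.
Qed.

(** Zero at [x] exactly when a nontrivial combination of [(u, m)] and [(v, n)] vanishes there, that
    is, when [x] is conjugate to [a] for the constrained problem. *)
Definition determinant (u v m n : R -> R) (x : R) : R := u x * n x - m x * v x.

Section JacobiFields.
Variables (a b : R) (P Q T u p v q m n : R -> R).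
Hypothesis J : jacobi_fields a b P Q T u p v q m n.

Local Notation D := (determinant u v m n).

(** Lagrange's identity: in [(p v - u q)'] the terms with [Q] and with [p q / P] cancel, leaving
    [u T = m']. Both sides vanish at [a]. *)
Lemma wronskian (x : R) : on_itv a b x -> m x = p x * v x - u x * q x.
Proof.
intros Hx.
assert (E : p x * v x - u x * q x - m x = p a * v a - u a * q a - m a).
{ apply (@constant_on_itv_closed (fun t => p t * v t - u t * q t - m t) a b); [|assumption].
  intros t Ht. pose proof (jf_u J Ht). pose proof (jf_p J Ht). pose proof (jf_v J Ht).
  pose proof (jf_q J Ht). pose proof (jf_m J Ht). pose proof (jf_pos J t).
  eapply is_derive_eq; [derive_rec|]. field. lra. }
rewrite (jf_pa J), (jf_qa J), (jf_ma J) in E. lra.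
Qed.

Ltac jf_facts Hx :=
  pose proof (jf_u J Hx); pose proof (jf_p J Hx); pose proof (jf_v J Hx);
  pose proof (jf_q J Hx); pose proof (jf_m J Hx); pose proof (jf_n J Hx).

Ltac jf_cont x Hx :=
  pose proof (jf_P J x); pose proof (jf_Q J x); pose proof (jf_T J x);
  pose proof (is_derive_continuous (jf_u J Hx));
  pose proof (is_derive_continuous (jf_p J Hx));
  pose proof (is_derive_continuous (jf_v J Hx));
  pose proof (is_derive_continuous (jf_q J Hx));
  pose proof (is_derive_continuous (jf_m J Hx));
  pose proof (is_derive_continuous (jf_n J Hx)).

Ltac nonzero :=
  repeat match goal with
  | |- _ * _ <> 0 => apply Rmult_integral_contrapositive_currified
  | |- _ ^ _ <> 0 => apply pow_nonzero
  end; auto.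

(** In the derivative of [D / u = n - m v / u] the terms with [T] cancel. What remains is
    [- m (v / u)'], and [(v / u)' = - m / (P u^2)] by the Wronskian identity. *)
Lemma is_derive_determinant_ratio (x : R) :
  on_itv a b x -> u x <> 0 -> is_derive (fun t => D t / u t) x (m x ^ 2 / (P x * u x ^ 2)).
Proof.
intros Hx U0. jf_facts Hx. pose proof (jf_pos J x).
unfold determinant. eapply is_derive_eq; [derive_rec; assumption|].
rewrite (wronskian Hx). field. split; [assumption|lra].
Qed.

(** Covers the interval next to [a], where [D a = 0] rules out dividing by [D]. The number [I] is
    the integral of [P rho^2], and the last inequality is Cauchy-Schwarz for the integral of
    [rho m / u]. *)
Lemma second_variation_initial (h dh k : R -> R) (e : R) :
  a <= e <= b -> (forall x, a <= x <= e -> u x <> 0) ->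
  piecewise_C1 h dh a e -> (forall x, continuous h x) ->
  (forall x, is_derive k x (h x * T x)) -> k a = 0 ->
  exists I, is_RInt (fun x => P x * dh x ^ 2 + Q x * h x ^ 2) a e (p e / u e * h e ^ 2 + I) /\
    0 <= D e / u e /\ (h e * m e / u e - k e) ^ 2 <= I * (D e / u e).
Proof.
intros He U0 Hh Ch Dk Ka.
assert (P0 : forall x, P x <> 0) by (intros x; pose proof (jf_pos J x); lra).
assert (Hin : forall x, a <= x <= e -> on_itv a b x) by (unfold on_itv; intros; lra).
(* [rho = u (h/u)'] *)
set (rho := fun x => dh x - h x * p x / (P x * u x)).
assert (Ex : ex_RInt (fun x => P x * rho x ^ 2) a e).
{ apply ex_RInt_ext with (fun x => P x * dh x ^ 2 + (- (2 * h x * p x / u x)) * dh x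
    + h x ^ 2 * p x ^ 2 / (P x * u x ^ 2)).
  { intros x. rewrite Rmin_left, Rmax_right by lra. intros Hx.
    unfold rho. real_field. split; [apply U0; lra|apply P0]. }
  apply piecewise_ex_RInt with h; [assumption|]. intros x Hx.
  pose proof (Ch x). jf_cont x (Hin x Hx). specialize (U0 x Hx).
  repeat split; continuity_rec; nonzero. }
destruct Ex as [I HI].
(* This integrand is [(p h^2 / u)'], whose primitive vanishes at [a] because [p a = 0]. *)
assert (HS : is_RInt (fun x => P x * dh x ^ 2 + Q x * h x ^ 2 - P x * rho x ^ 2) a e
  (p e / u e * h e ^ 2)).
{ replace (p e / u e * h e ^ 2) with (p e / u e * h e ^ 2 - p a / u a * h a ^ 2)
    by (rewrite (jf_pa J); field; split; apply U0; lra).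
  apply is_RInt_ext with (fun x => 0 * dh x ^ 2 + 2 * h x * p x / u x * dh x
    + (Q x * h x ^ 2 - h x ^ 2 * p x ^ 2 / (P x * u x ^ 2))).
  { intros x. rewrite Rmin_left, Rmax_right by lra. intros Hx.
    unfold rho. real_field. split; [apply U0; lra|apply P0]. }
  apply (@piecewise_ftc h dh (fun x => p x / u x * h x ^ 2)); [assumption| |].
  - intros x Hx. pose proof (Ch x). jf_cont x (Hin x Hx). specialize (U0 x Hx).
    repeat split; continuity_rec; nonzero.
  - intros x Hx Dh. assert (Hx' : on_itv a b x) by (apply Hin; lra). jf_facts Hx'.
    assert (u x <> 0) by (apply U0; lra).
    eapply is_derive_eq; [derive_rec; assumption|]. field. auto. }
(* [(h m / u - k)' = rho m / u], since the terms with [T] cancel; [m] and [k] vanish at [a]. *)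
assert (HC : is_RInt (fun x => rho x * m x / u x) a e (h e * m e / u e - k e)).
{ replace (h e * m e / u e - k e) with (h e * m e / u e - k e - (h a * m a / u a - k a))
    by (rewrite (jf_ma J), Ka; field; split; apply U0; lra).
  apply is_RInt_ext with (fun x => 0 * dh x ^ 2 + m x / u x * dh x
    + (- (h x * m x * p x / (P x * u x ^ 2)))).
  { intros x. rewrite Rmin_left, Rmax_right by lra. intros Hx.
    unfold rho. real_field. split; [apply U0; lra|apply P0]. }
  apply (@piecewise_ftc h dh (fun x => h x * m x / u x - k x)); [assumption| |].
  - intros x Hx. pose proof (Ch x). jf_cont x (Hin x Hx). specialize (U0 x Hx).
    pose proof (is_derive_continuous (Dk x)).
    repeat split; continuity_rec; nonzero.
  - intros x Hx Dh. assert (Hx' : on_itv a b x) by (apply Hin; lra). jf_facts Hx'.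
    assert (u x <> 0) by (apply U0; lra). pose proof (Dk x).
    eapply is_derive_eq; [derive_rec; assumption|]. field. auto. }
assert (HD : is_RInt (fun x => m x ^ 2 / (P x * u x ^ 2)) a e (D e / u e)).
{ replace (D e / u e) with (minus (D e / u e) (D a / u a))
    by (unfold minus, plus, opp, determinant; simpl; rewrite (jf_ma J), (jf_na J); field;
        split; apply U0; lra).
  apply (is_RInt_derive (V := R_CompleteNormedModule) (fun x => D x / u x));
    rewrite Rmin_left, Rmax_right by lra; intros x Hx; specialize (U0 x Hx).
  - apply is_derive_determinant_ratio; auto.
  - jf_cont x (Hin x Hx). continuity_rec. nonzero. }
exists I. split; [|split].
- apply is_RInt_ext with (fun x => plus (P x * dh x ^ 2 + Q x * h x ^ 2 - P x * rho x ^ 2)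
    (P x * rho x ^ 2)); [intros x _; unfold plus; simpl; ring|].
  apply (is_RInt_plus (V := R_NormedModule)); assumption.
- apply (is_RInt_ge_0 _ a e _ (proj1 He) HD). intros x Hx.
  apply Rdiv_le_0_compat; [apply pow2_ge_0|].
  apply Rmult_lt_0_compat; [apply (jf_pos J)|]. apply pow2_gt_0, U0; lra.
- apply (RInt_cauchy_schwarz (proj1 He) HI HC HD). intros x Hx.
  assert (u x <> 0) by (apply U0; lra). pose proof (jf_pos J x). split; [|split].
  + apply Rmult_le_pos; [lra|apply pow2_ge_0].
  + apply Rdiv_le_0_compat; [apply pow2_ge_0|].
    apply Rmult_lt_0_compat; [assumption|]. now apply pow2_gt_0.
  + right. field. auto.
Qed.

(** The quadratic form [h (alpha p + beta q) + beta k], where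
    [(h, k) = alpha (u, m) + beta (v, n)]. *)
Definition field_form (h k : R -> R) (x : R) : R :=
  ((n x * p x - m x * q x) * h x ^ 2 - 2 * m x * h x * k x + u x * k x ^ 2) / D x.

(** Completing the square along the field through [(h, k)] leaves [I], the integral of [P delta^2].
    If [I = 0], the coefficients [alpha] and [beta] keep the same values at [c] and [d]; when [h]
    and [k] vanish at [d], these are 0, which forces [h c = 0]. *)
Lemma second_variation_field (h dh k : R -> R) (c d : R) :
  a <= c -> c <= d -> d <= b -> (forall x, c <= x <= d -> D x <> 0) ->
  piecewise_C1 h dh c d -> (forall x, continuous h x) ->
  (forall x, is_derive k x (h x * T x)) ->
  exists I, 0 <= I /\
    is_RInt (fun x => P x * dh x ^ 2 + Q x * h x ^ 2) c d
      (I + (field_form h k d - field_form h k c)) /\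
    (h c <> 0 -> h d = 0 -> k d = 0 -> 0 < I).
Proof.
intros Hac Hcd Hdb D0 Hh Ch Dk.
assert (P0 : forall x, P x <> 0) by (intros x; pose proof (jf_pos J x); lra).
assert (Hin : forall x, c <= x <= d -> on_itv a b x) by (unfold on_itv; intros; lra).
(* By the Wronskian identity [sigma] is the momentum [alpha p + beta q]; [delta] is the deviation of
   [h'] from the slope of the field. *)
set (sigma := fun x => ((n x * p x - m x * q x) * h x - m x * k x) / D x).
set (delta := fun x => dh x - sigma x / P x).
assert (Ck : forall x, continuous k x) by (intros x; apply (is_derive_continuous (Dk x))).
assert (Ex : ex_RInt (fun x => P x * delta x ^ 2) c d).
{ apply ex_RInt_ext with (fun x => P x * dh x ^ 2 + (- (2 * sigma x)) * dh x
    + sigma x ^ 2 / P x).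
  { intros x _. unfold delta. real_field. apply P0. }
  apply piecewise_ex_RInt with h; [assumption|]. intros x Hx.
  pose proof (Ch x). pose proof (Ck x). jf_cont x (Hin x Hx). specialize (D0 x Hx).
  unfold sigma, determinant in *. repeat split; continuity_rec; nonzero. }
destruct Ex as [I HI]. exists I.
assert (I0 : 0 <= I).
{ apply (is_RInt_ge_0 _ c d _ Hcd HI). intros x _. pose proof (jf_pos J x).
  apply Rmult_le_pos; [lra|apply pow2_ge_0]. }
assert (Hfact : forall x, c < x < d -> on_itv a b x /\ u x * n x - m x * v x <> 0)
  by (intros x Hx; split; [apply Hin; lra|apply D0; lra]).
split; [assumption|split].
(* Apart from the square, the integrand is [2 sigma h' + Q h^2 - sigma^2 / P], the derivative of
   [field_form]. *)
- apply is_RInt_ext with (fun x => plus (P x * delta x ^ 2)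
    (0 * dh x ^ 2 + 2 * sigma x * dh x + (Q x * h x ^ 2 - sigma x ^ 2 / P x))).
  { intros x _. unfold plus, delta; simpl. real_field. apply P0. }
  apply (is_RInt_plus (V := R_NormedModule)); [assumption|].
  apply piecewise_ftc with h; [assumption| |].
  + intros x Hx. pose proof (Ch x). pose proof (Ck x). jf_cont x (Hin x Hx).
    specialize (D0 x Hx). unfold field_form, sigma, determinant in *.
    repeat split; continuity_rec; nonzero.
  + intros x Hx Dh. destruct (Hfact x Hx) as [Hx' Dx]. jf_facts Hx'. pose proof (Dk x).
    unfold field_form, sigma, determinant.
    eapply is_derive_eq; [derive_rec; assumption|].
    rewrite (wronskian Hx') in Dx |- *. field. auto.
- intros Hc Hd Kd. destruct I0 as [|I0]; [assumption|exfalso]. subst I.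
  (* [alpha' = n delta / D] and [beta' = - m delta / D] *)
  set (alpha := fun x => (n x * h x - v x * k x) / D x).
  set (beta := fun x => (u x * k x - m x * h x) / D x).
  (* By Cauchy-Schwarz, [(g d - g c)^2] is at most [I = 0] times a finite integral, so [delta] need
     not be shown to vanish pointwise. *)
  assert (Hcoef : forall f g : R -> R,
    (forall x, c <= x <= d -> continuous f x) -> (forall x, c <= x <= d -> continuous g x) ->
    g d = 0 ->
    (forall x, c < x < d -> is_derive h x (dh x) -> is_derive g x (f x * delta x / D x)) ->
    g c = 0).
  { intros f g Cf Cg Gd Dg.
    assert (H1 : is_RInt (fun x => f x * delta x / D x) c d (g d - g c)).
    { apply is_RInt_ext with (fun x => 0 * dh x ^ 2 + f x / D x * dh x
        + (- (f x * sigma x / (P x * D x)))).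
      { intros x. rewrite Rmin_left, Rmax_right by lra. intros Hx.
        unfold delta. real_field. split; solve [apply P0|apply D0; lra]. }
      apply piecewise_ftc with h; [assumption| |].
      - intros x Hx. pose proof (Ch x). pose proof (Ck x). pose proof (Cf x Hx).
        pose proof (Cg x Hx). jf_cont x (Hin x Hx).
        specialize (D0 x Hx). unfold sigma, determinant in *.
        repeat split; continuity_rec; nonzero.
      - intros x Hx Dh. eapply is_derive_eq; [now apply Dg|].
        unfold delta. field. split; solve [apply P0|apply D0; lra]. }
    assert (H2 : ex_RInt (fun x => f x ^ 2 / (P x * D x ^ 2)) c d).
    { apply (ex_RInt_continuous (V := R_CompleteNormedModule)).
      rewrite Rmin_left, Rmax_right by lra. intros x Hx. pose proof (Cf x Hx).
      jf_cont x (Hin x Hx). specialize (D0 x Hx). unfold determinant in *. continuity_rec; nonzero. }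
    destruct H2 as [K HK].
    assert ((g d - g c) ^ 2 <= 0 * K); [|rewrite Gd in *; nra].
    apply (RInt_cauchy_schwarz Hcd HI H1 HK). intros x Hx.
    assert (D x <> 0) by (apply D0; lra). pose proof (jf_pos J x). split; [|split].
    - apply Rmult_le_pos; [lra|apply pow2_ge_0].
    - apply Rdiv_le_0_compat; [apply pow2_ge_0|].
      apply Rmult_lt_0_compat; [assumption|]. now apply pow2_gt_0.
    - right. field. auto. }
  assert (Ha : alpha c = 0).
  { apply (Hcoef n).
    - intros x Hx. now jf_cont x (Hin x Hx).
    - intros x Hx. pose proof (Ch x). pose proof (Ck x). jf_cont x (Hin x Hx).
      specialize (D0 x Hx). unfold alpha, determinant in *. continuity_rec; nonzero.
    - unfold alpha. rewrite Hd, Kd. field. apply D0; lra.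
    - intros x Hx Dh. destruct (Hfact x Hx) as [Hx' Dx]. jf_facts Hx'. pose proof (Dk x).
      unfold alpha, delta, sigma, determinant.
      eapply is_derive_eq; [derive_rec; assumption|].
      rewrite (wronskian Hx') in Dx |- *. field. auto. }
  assert (Hb : beta c = 0).
  { apply (Hcoef (fun x => - m x)).
    - intros x Hx. jf_cont x (Hin x Hx). continuity_rec.
    - intros x Hx. pose proof (Ch x). pose proof (Ck x). jf_cont x (Hin x Hx).
      specialize (D0 x Hx). unfold beta, determinant in *. continuity_rec; nonzero.
    - unfold beta. rewrite Hd, Kd. field. apply D0; lra.
    - intros x Hx Dh. destruct (Hfact x Hx) as [Hx' Dx]. jf_facts Hx'. pose proof (Dk x).
      unfold beta, delta, sigma, determinant.
      eapply is_derive_eq; [derive_rec; assumption|].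
      rewrite (wronskian Hx') in Dx |- *. field. auto. }
  apply Hc. replace (h c) with (alpha c * u c + beta c * v c).
  + rewrite Ha, Hb. ring.
  + unfold alpha, beta. assert (Dc : D c <> 0) by (apply D0; lra).
    unfold determinant in *. field. exact Dc.
Qed.

(** The interval is cut at [e] and at a point [x0] with [h x0 <> 0]. The Jacobi identity serves on
    [[a, e]]; the field identity gives a nonnegative square term on [[e, x0]] and a positive one on
    [[x0, b]], while the boundary terms at [x0] cancel. *)
Lemma second_variation_positive (h dh k : R -> R) :
  a < b -> (forall x, a < x <= b -> D x <> 0) ->
  piecewise_C1 h dh a b -> (forall x, continuous h x) ->
  (forall x, is_derive k x (h x * T x)) -> k a = 0 -> k b = 0 -> h b = 0 ->
  not_identically_zero a b h ->
  exists I, 0 < I /\ is_RInt (fun x => P x * dh x ^ 2 + Q x * h x ^ 2) a b I.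
Proof.
intros Hab D0 Hh Ch Dk Ka Kb Hb Hnz.
(* If [h] is only known to be nonzero at [a], continuity provides a point to the right of [a]. *)
assert (exists x0, a < x0 <= b /\ h x0 <> 0) as (x0 & Hx0 & H0).
{ destruct Hnz as (x & [H1 H2] & Hx). destruct H1 as [H1|H1].
  - exists x; split; [lra|assumption].
  - subst x. destruct (nonzero_near (Ch a) Hx) as [d [Hd N]].
    pose proof (Rmin_l d (b - a)). pose proof (Rmin_r d (b - a)).
    assert (0 < Rmin d (b - a)) by (apply Rmin_glb_lt; lra).
    exists (a + Rmin d (b - a) / 2). split; [lra|]. apply N. rewrite Rabs_pos_eq; lra. }
assert (exists e, a < e <= x0 /\ forall x, a <= x <= e -> u x <> 0) as (e & He & U0).
{ assert (Ha : on_itv a b a) by (unfold on_itv; lra).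
  destruct (nonzero_near (is_derive_continuous (jf_u J Ha)) (jf_ua J)) as [d [Hd N]].
  pose proof (Rmin_l d (x0 - a)). pose proof (Rmin_r d (x0 - a)).
  assert (0 < Rmin d (x0 - a)) by (apply Rmin_glb_lt; lra).
  exists (a + Rmin d (x0 - a) / 2). split; [lra|]. intros x Hx. apply N.
  rewrite Rabs_pos_eq; lra. }
assert (D1 : forall x, e <= x <= b -> D x <> 0) by (intros; apply D0; lra).
destruct (@second_variation_initial h dh k e) as (I0 & R0 & Hr & CS); auto; [lra| |].
{ apply piecewise_C1_sub with a b; auto; lra. }
destruct (@second_variation_field h dh k e x0) as (I1 & P1 & R1 & _); auto; try lra.
{ intros; apply D1; lra. }
{ apply piecewise_C1_sub with a b; auto; lra. }
destruct (@second_variation_field h dh k x0 b) as (I2 & _ & R2 & P2); auto; try lra.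
{ intros; apply D1; lra. }
{ apply piecewise_C1_sub with a b; auto; lra. }
specialize (P2 H0 Hb Kb).
assert (Fb : field_form h k b = 0).
{ unfold field_form. rewrite Hb, Kb. field. apply D1; lra. }
pose proof (is_RInt_Chasles (V := R_NormedModule) _ _ _ _ _ _
  (is_RInt_Chasles (V := R_NormedModule) _ _ _ _ _ _ R0 R1) R2) as RT.
eexists; split; [|exact RT]. unfold plus; simpl. rewrite Fb.
assert (field_form h k e <= p e / u e * h e ^ 2 + I0); [|lra].
assert (Ue : u e <> 0) by (apply U0; lra). assert (De : D e <> 0) by (apply D1; lra).
assert (0 < D e / u e).
{ destruct Hr as [|Hr]; [assumption|]. exfalso. symmetry in Hr.
  apply (Rmult_integral_contrapositive_currified _ _ De (Rinv_neq_0_compat _ Ue)), Hr. }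
(* The two boundary terms at [e] differ by this square, which the Cauchy-Schwarz bound dominates by
   [I0]. *)
replace (field_form h k e) with
  (p e / u e * h e ^ 2 + (h e * m e / u e - k e) ^ 2 / (D e / u e)).
- apply Rplus_le_compat_l, Rle_div_l; lra.
- assert (He' : on_itv a b e) by (unfold on_itv; lra).
  unfold field_form, determinant in *. rewrite (wronskian He') in De |- *. field.
  repeat split; auto.
Qed.

(** A singular matrix at [c] yields a solution [w] with multiplier [al] for which both [w] and the
    integral of [w T] vanish at [c]. Integration by parts then makes its quadratic functional
    zero. *)
Lemma degenerate_variation (c : R) :
  a < c <= b -> D c = 0 -> not_identically_zero a c T ->
  exists w r, (forall x, on_itv a b x -> is_derive w x (r x / P x)) /\
    (forall x, on_itv a b x -> continuous r x) /\
    r a = 0 /\ w c = 0 /\ not_identically_zero a c w /\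
    is_RInt (fun x => w x * T x) a c 0 /\
    is_RInt (fun x => P x * (r x / P x) ^ 2 + Q x * w x ^ 2) a c 0.
Proof.
intros Hc Dc HT.
assert (P0 : forall x, P x <> 0) by (intros x; pose proof (jf_pos J x); lra).
(* A kernel vector of the singular matrix with rows [(v c, u c)] and [(n c, m c)], read off from a
   nonzero entry. *)
assert (exists al be, (al <> 0 \/ be <> 0) /\
  al * v c + be * u c = 0 /\ al * n c + be * m c = 0) as (al & be & Hne & E1 & E2).
{ unfold determinant in Dc. destruct (Req_dec (u c) 0) as [Uc|Uc].
  - destruct (Req_dec (v c) 0) as [Vc|Vc].
    + destruct (Req_dec (m c) 0) as [Mc|Mc].
      * exists 0, 1. repeat split; [right; lra| |]; rewrite ?Uc, ?Mc; ring.
      * exists (m c), (- n c). repeat split; [now left| |]; rewrite ?Uc, ?Vc; ring.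
    + exists (u c), (- v c). repeat split; [right; lra|ring|lra].
  - exists (u c), (- v c). repeat split; [now left|ring|lra]. }
set (w := fun x => al * v x + be * u x). set (r := fun x => al * q x + be * p x).
assert (Hin : forall x, a <= x <= c -> on_itv a b x) by (unfold on_itv; intros; lra).
assert (Dw : forall x, on_itv a b x -> is_derive w x (r x / P x)).
{ intros x Hx. jf_facts Hx. unfold w, r. eapply is_derive_eq; [derive_rec|].
  field. apply P0. }
assert (Dr : forall x, on_itv a b x -> is_derive r x (Q x * w x - al * T x)).
{ intros x Hx. jf_facts Hx. unfold w, r. eapply is_derive_eq; [derive_rec|].
  ring. }
assert (Dk : forall x, on_itv a b x -> is_derive (fun x => al * n x + be * m x) x (w x * T x)).
{ intros x Hx. jf_facts Hx. unfold w, r. eapply is_derive_eq; [derive_rec|].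
  ring. }
exists w, r. split; [assumption|]. split; [intros x Hx; apply (is_derive_continuous (Dr x Hx))|].
split; [unfold r; rewrite (jf_pa J), (jf_qa J); ring|]. split; [exact E1|]. split; [|split].
(* If [w] vanished on [[a, c]], so would its momentum inside, and then [al T]. As [T] does not
   vanish identically, [al = 0]; then [be u a = 0] with [u a <> 0] leaves no nonzero coefficient. *)
- destruct (classic (not_identically_zero a c w)) as [|Hw]; [assumption|exfalso].
  assert (W0 : forall x, a <= x <= c -> w x = 0).
  { intros x Hx. apply NNPP. intros Wx. apply Hw. now exists x. }
  assert (Hloc : forall f : R -> R, forall l x, (forall x, a < x < c -> f x = 0) ->
    a < x < c -> is_derive f x l -> l = 0).
  { intros f l x Hf Hx Df. rewrite <- (is_derive_unique _ _ _ Df).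
    rewrite (Derive_ext_loc f (fun _ => 0)); [apply Derive_const|].
    apply filter_imp with (fun t => a < t < c); [exact Hf|].
    apply (open_and _ _ (open_gt a) (open_lt c)); lra. }
  assert (R0 : forall x, a < x < c -> r x = 0).
  { intros x Hx. assert (E : r x / P x = 0).
    { apply (Hloc w _ x); [intros; apply W0; lra|assumption|apply Dw, Hin; lra]. }
    replace (r x) with (r x / P x * P x) by (field; apply P0). rewrite E; ring. }
  assert (T0 : forall x, a < x < c -> al * T x = 0).
  { intros x Hx. assert (E : Q x * w x - al * T x = 0).
    { apply (Hloc r _ x); [assumption|assumption|apply Dr, Hin; lra]. }
    rewrite W0 in E by lra. lra. }
  assert (Hal : al = 0).
  { apply NNPP. intros Hal. destruct HT as (x & [Hx1 Hx2] & Tx).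
    destruct (nonzero_near (jf_T J x) Tx) as [d [Hd N]].
    (* The point where [T] is nonzero may be an end of [[a, c]]; it is moved towards the side with
       more room. *)
    assert (exists t, a < t < c /\ Rabs (t - x) < d) as (t & Ht & Hlt).
    { pose proof (Rmin_l d (c - a)). pose proof (Rmin_r d (c - a)).
      assert (0 < Rmin d (c - a)) by (apply Rmin_glb_lt; lra).
      destruct (Rle_dec x ((a + c) / 2)).
      - exists (x + Rmin d (c - a) / 4). rewrite Rabs_pos_eq; lra.
      - exists (x - Rmin d (c - a) / 4). rewrite Rabs_left; lra. }
    apply (N t Hlt). destruct (Rmult_integral _ _ (T0 t Ht)); [contradiction|assumption]. }
  assert (Hwa : w a = 0) by (apply W0; lra). unfold w in Hwa. rewrite Hal in *.
  destruct Hne as [|Hbe]; [lra|].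
  destruct (Rmult_integral be (u a)); [lra|contradiction|now apply (jf_ua J)].
- replace 0 with (minus (al * n c + be * m c) (al * n a + be * m a))
    by (unfold minus, plus, opp; simpl; rewrite (jf_na J), (jf_ma J); lra).
  apply (is_RInt_derive (V := R_CompleteNormedModule) (fun x => al * n x + be * m x));
    rewrite Rmin_left, Rmax_right by lra; intros x Hx.
  + apply Dk, Hin, Hx.
  + pose proof (is_derive_continuous (Dw x (Hin x Hx))). pose proof (jf_T J x). continuity_rec.
(* In [(w r)' = r^2 / P + Q w^2 - al w T] the last term is cancelled by the derivative of the second
   summand of [F]. *)
- set (F := fun x => w x * r x + al * (al * n x + be * m x)).
  replace 0 with (minus (F c) (F a)).
  2:{ unfold minus, plus, opp, F; simpl. rewrite E2.
      replace (w c) with 0 by (symmetry; exact E1).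
      unfold r. rewrite (jf_pa J), (jf_qa J), (jf_na J), (jf_ma J). ring. }
  apply (is_RInt_derive (V := R_CompleteNormedModule) F);
    rewrite Rmin_left, Rmax_right by lra; intros x Hx; specialize (Hin x Hx).
  + pose proof (Dw x Hin). pose proof (Dr x Hin). pose proof (Dk x Hin).
    unfold F. eapply is_derive_eq.
    * apply is_derive_Rplus; [derive_rec|].
      apply (is_derive_scal (fun x => al * n x + be * m x)). eassumption.
    * field. apply P0.
  + pose proof (is_derive_continuous (Dw x Hin)). pose proof (is_derive_continuous (Dr x Hin)).
    jf_cont x Hin. continuity_rec. apply P0.
Qed.

End JacobiFields.

(** * Reduction to the quadratic functional *)

(** [y] and its derivative are extended separately to C^1 functions on the line, so the chain rule
    applies at the endpoints as well. *)
Lemma along_Ck1 (a b : R) (Omega : R * R * R -> Prop) (y : R -> R) (f : R -> R -> R -> R) :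
  a < b -> open Omega -> Ck_on 2 a b y ->
  (forall x, on_itv a b x -> Omega (x, y x, deriv_on a b y x)) ->
  Ck3 1 Omega f -> Ck_on 1 a b (along a b y f).
Proof.
intros Hab HO (Cy & Dy & Cdy) HOm Hf.
destruct (@C1_extension a b y Hab) as (Y & dY & EY & DY & CdY & _).
{ split; [assumption|split; [assumption|apply Cdy]]. }
destruct (C1_extension Hab Cdy) as (Z & dZ & EZ & DZ & CdZ & _).
assert (HX : forall x, on_itv a b x -> Omega (x, Y x, Z x))
  by (intros x Hx; rewrite EY, EZ by assumption; auto).
apply Ck_on1_intro with (fun x => f x (Y x) (Z x))
  (fun x => d_x f x (Y x) (Z x) + d_y f x (Y x) (Z x) * dY x + d_z f x (Y x) (Z x) * dZ x).
- assumption.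
- intros x Hx. unfold along. now rewrite EY, EZ.
- intros x Hx. apply Ck3_chain_rule with Omega; auto.
- intros x Hx. destruct Hf as (_ & _ & Kx & Ky & Kz).
  pose proof (CdY x). pose proof (CdZ x).
  pose proof (is_derive_continuous (DY x)). pose proof (is_derive_continuous (DZ x)).
  pose proof (@continuous_curve Omega (d_x f) Y Z x HO Kx (HX x Hx)).
  pose proof (@continuous_curve Omega (d_y f) Y Z x HO Ky (HX x Hx)).
  pose proof (@continuous_curve Omega (d_z f) Y Z x HO Kz (HX x Hx)).
  continuity_rec; auto.
Qed.

Lemma continuous_on_minus (a b : R) (f g : R -> R) :
  a <= b -> continuous_on (on_itv a b) f -> continuous_on (on_itv a b) g ->
  continuous_on (on_itv a b) (fun x => f x - g x).
Proof.
intros Hab Cf Cg.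
apply continuous_on_itv_ext with (fun x => clamp a b f x - clamp a b g x).
- intros x Hx. now rewrite !clamp_eq.
- apply continuous_on_of_continuous. intros x _.
  pose proof (continuous_clamp x Hab Cf). pose proof (continuous_clamp x Hab Cg).
  continuity_rec.
Qed.

Lemma Ck_on1_mult (a b : R) (f g : R -> R) :
  a < b -> Ck_on 1 a b f -> Ck_on 1 a b g -> Ck_on 1 a b (fun x => f x * g x).
Proof.
intros Hab Hf Hg.
destruct (C1_extension Hab Hf) as (F & dF & EF & DF & CdF & _).
destruct (C1_extension Hab Hg) as (G & dG & EG & DG & CdG & _).
apply Ck_on1_intro with (fun x => F x * G x) (fun x => dF x * G x + F x * dG x).
- assumption.
- intros x Hx. now rewrite EF, EG.
- intros x _. now apply is_derive_Rmult.
- intros x _. pose proof (CdF x). pose proof (CdG x).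
  pose proof (is_derive_continuous (DF x)). pose proof (is_derive_continuous (DG x)).
  continuity_rec.
Qed.

(** The second-order equation becomes a first-order system for [w] and its momentum [r = P w'], with
    derivatives two-sided even at [a] and [b]. *)
Lemma jacobi_solution_system (a b : R) (P Q f w : R -> R) :
  a < b -> Ck_on 1 a b P -> (forall x, on_itv a b x -> P x > 0) ->
  jacobi_solution a b P Q f w -> deriv_on a b w a = 0 ->
  exists W r, (forall x, on_itv a b x -> W x = w x) /\ (forall x, continuous W x) /\
    r a = 0 /\
    (forall x, on_itv a b x -> is_derive W x (r x / clamp a b P x)) /\
    (forall x, on_itv a b x ->
      is_derive r x (clamp a b Q x * W x - clamp a b f x)).
Proof.
intros Hab HP P0 [[Cw [Dw Cdw]] Hw] Da.
destruct (@C1_extension a b w Hab) as (W & dW & EW & DW & CdW & EdW).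
{ split; [assumption|split; [assumption|apply Cdw]]. }
destruct (C1_extension Hab (Ck_on1_mult Hab HP Cdw)) as (r & dr & Er & Dr & _ & Edr).
exists W, r. split; [assumption|]. split; [|split; [|split]].
- intros x. exact (is_derive_continuous (DW x)).
- rewrite Er by (unfold on_itv; lra). rewrite Da; ring.
- intros x Hx. eapply is_derive_eq; [apply DW|].
  rewrite EdW, Er, clamp_eq by assumption. field. specialize (P0 x Hx). lra.
- intros x Hx. eapply is_derive_eq; [apply Dr|].
  rewrite Edr, EW, !clamp_eq by assumption.
  specialize (Hw x Hx). unfold jacobi_op in Hw. lra.
Qed.

Lemma is_RInt_eq (f : R -> R) (a b l l' : R) : is_RInt f a b l -> l = l' -> is_RInt f a b l'.
Proof. now intros H <-. Qed.

(** As [w c = 0], clamping to [[a, c]] extends [w] by zero beyond [c]. *)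
Lemma extension_by_zero (a b c : R) (w dw : R -> R) :
  a < c <= b -> (forall x, on_itv a c x -> is_derive w x (dw x)) ->
  (forall x, on_itv a c x -> continuous dw x) -> dw a = 0 -> w c = 0 ->
  let h := clamp a c w in
  piecewise_smooth a b h /\ deriv_on a b h a = 0 /\
  (forall x, on_itv a c x -> h x = w x) /\ (forall x, c <= x -> h x = 0) /\
  (forall x, a < x < c -> deriv_on a b h x = dw x) /\
  (forall x, c < x < b -> deriv_on a b h x = 0).
Proof.
intros Hc Dw Cdw Da Wc h.
assert (Hab : a < b) by lra.
assert (Hw : forall x, on_itv a c x -> h x = w x) by (intros x Hx; now apply clamp_eq).
assert (H0 : forall x, c <= x -> h x = 0).
{ intros x Hx. unfold h, clamp. rewrite Rmin_left, Rmax_right by lra. exact Wc. }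
split; [split|split; [|split; [|split; [|split]]]].
- apply continuous_on_of_continuous. intros x _. apply continuous_clamp; [lra|].
  apply continuous_on_of_continuous. intros z Hz. exact (is_derive_continuous (Dw z Hz)).
- assert (HC1 : Ck_on 1 a c h).
  { apply Ck_on1_intro with w dw; auto; [lra|]. intros x Hx; symmetry; auto. }
  destruct (Rlt_dec c b) as [Hcb|Hcb].
  + assert (HC2 : Ck_on 1 c b h).
    { apply Ck_on1_intro with (fun _ => 0) (fun _ => 0); auto.
      - intros x [Hx _]. symmetry; auto.
      - intros x _. apply is_derive_Rconst.
      - intros x _. apply continuous_const. }
    exists 2%nat, (fun i => match i with O => a | 1%nat => c | _ => b end).
    split; [reflexivity|]. split; [reflexivity|].
    split; intros [|[|i]] Hi; try lia; auto; lra.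
  + replace b with c by lra. exists 1%nat, (fun i => match i with O => a | _ => c end).
    split; [reflexivity|]. split; [reflexivity|].
    split; intros [|i] Hi; try lia; auto; lra.
- apply is_deriv_on_unique; [lra|unfold on_itv; lra|].
  assert (Ha : on_itv a c a) by (unfold on_itv; lra).
  pose proof (Dw a Ha) as Dwa. rewrite Da, is_derive_spec in Dwa.
  rewrite is_deriv_on_spec. intros eps Heps. destruct (Dwa eps Heps) as [d [Hd Hlt]].
  pose proof (Rmin_l d (c - a)). pose proof (Rmin_r d (c - a)).
  exists (Rmin d (c - a)); split; [apply Rmin_glb_lt; lra|].
  intros t [Ht1 Ht2] Hne Hta. rewrite Rabs_pos_eq in Hta by lra.
  rewrite !Hw by (unfold on_itv; lra). apply Hlt; [assumption|]. rewrite Rabs_pos_eq; lra.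
- assumption.
- assumption.
- intros x Hx. apply is_deriv_on_unique; [lra|unfold on_itv; lra|].
  apply is_derive_deriv_on, is_derive_ext_loc with w; [|apply Dw; unfold on_itv; lra].
  apply filter_imp with (fun t => a < t < c).
  + intros t Ht. symmetry; apply Hw. unfold on_itv; lra.
  + apply (open_and _ _ (open_gt a) (open_lt c)); lra.
- intros x Hx. apply is_deriv_on_unique; [lra|unfold on_itv; lra|].
  apply is_derive_deriv_on, is_derive_ext_loc with (fun _ => 0); [|apply is_derive_Rconst].
  apply filter_imp with (fun t => c < t).
  + intros t Ht. symmetry; apply H0. lra.
  + apply (open_gt c); lra.
Qed.

Lemma is_RInt_extension_by_zero (f g : R -> R) (a b c l : R) :
  a < c <= b -> (forall x, a < x < c -> f x = g x) -> (forall x, c < x < b -> g x = 0) ->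
  is_RInt f a c l -> is_RInt g a b l.
Proof.
intros Hc E1 E2 H. apply is_RInt_eq with (plus l (scal (b - c) 0)).
- apply (is_RInt_Chasles (V := R_NormedModule)) with c.
  + apply is_RInt_ext with f; [|assumption].
    intros x. rewrite Rmin_left, Rmax_right by lra. apply E1.
  + apply is_RInt_ext with (fun _ => 0); [|apply (is_RInt_const (V := R_NormedModule))].
    intros x. rewrite Rmin_left, Rmax_right by lra. intros Hx; symmetry; auto.
- unfold plus, scal; simpl; unfold mult; simpl; ring.
Qed.

(* [F] and [G] need only be C^3 on an open set [Omega] containing the curve
   (x, y(x), y'(x)), e.g. all of R^3, and [y] need only be C^2.

   "T is not identically zero" is required on every initial subinterval [a, c]
   of [a, b] (the case c = b is [a, b] itself): if T vanished on some [a, c],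
   Delta would vanish on [a, c] whatever the sign of the second variation. *)
Theorem theorem4 :
  forall (a b : R) (F G : R -> R -> R -> R) (Omega : R * R * R -> Prop)
    (ell B lambda : R) (y u v : R -> R),
  let H := lagrangian F G lambda in
  let P := coef_P a b y H in
  let Rc := coef_R a b y H in
  let Q := coef_Q a b y H in
  let T := euler_lagrange a b y G in
  let m := fun x => RInt (fun t => u t * T t) a x in
  let n := fun x => RInt (fun t => v t * T t) a x in
  let Delta := fun x => m x * v x - n x * u x in
  a < b ->
  open Omega -> Ck3 3 Omega F -> Ck3 3 Omega G ->
  Ck_on 2 a b y ->
  (forall x, on_itv a b x -> Omega (x, y x, deriv_on a b y x)) ->
  is_extremal a b F G ell B lambda y ->
  (forall x, on_itv a b x -> P x > 0) ->
  (forall c, a < c <= b -> not_identically_zero a c T) ->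
  Rc a = 0 ->
  along a b y (d_z G) a = 0 ->
  jacobi_solution a b P Q (fun _ => 0) u ->
  not_identically_zero a b u ->
  deriv_on a b u a = 0 ->
  jacobi_solution a b P Q T v ->
  not_identically_zero a b v ->
  deriv_on a b v a = 0 ->
  (forall h : R -> R,
     piecewise_smooth a b h ->
     not_identically_zero a b h ->
     deriv_on a b h a = 0 ->
     h b = 0 ->
     end_diff a b (fun x => along a b y (d_z G) x * h x) +
       RInt (fun x => h x * T x) a b = 0 ->
     second_variation a b P Q Rc h > 0)
  <->
  (forall x, a < x <= b -> Delta x <> 0).
Proof.
intros a b F G Omega ell B lambda y u v H P Rc Q T m n Delta
  Hab HO HF HG Hy HOm _ P0 HT Ra Ga Hu Hunz Dua Hv _ Dva.
assert (HH : Ck3 3 Omega H) by now apply Ck3_lagrangian.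
assert (Hle : a <= b) by lra.
assert (Haa : on_itv a b a) by (unfold on_itv; lra).
assert (CP : Ck_on 1 a b P)
  by (apply along_Ck1 with Omega; auto; apply HH).
assert (CQ : continuous_on (on_itv a b) Q).
{ apply continuous_on_minus; [assumption| |].
  - apply (@along_Ck1 a b Omega y (d_y (d_y H))); auto; apply HH.
  - apply (@along_Ck1 a b Omega y (d_y (d_z H))); auto; apply HH. }
assert (K1 : forall f, Ck3 2 Omega f -> Ck3 1 Omega f).
{ intros f (K & D & (Kx & _) & (Ky & _) & (Kz & _)).
  exact (conj K (conj D (conj Kx (conj Ky Kz)))). }
assert (CT : continuous_on (on_itv a b) T).
{ apply continuous_on_minus; [assumption| |];
    [apply (@along_Ck1 a b Omega y (d_y G))|apply (@along_Ck1 a b Omega y (d_z G))];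
    auto; apply K1, HG. }
destruct (jacobi_solution_system Hab CP P0 Hu Dua) as (U & p & EU & CU & Pa & DU & Dp).
destruct (jacobi_solution_system Hab CP P0 Hv Dva) as (V & q & EV & CV & Qa & DV & Dq).
(* The coefficients are continued to the whole line; all integrals over [[a, b]] keep their
   values. *)
set (Pc := clamp a b P) in *. set (Qc := clamp a b Q) in *. set (Tc := clamp a b T) in *.
assert (CPc : forall x, continuous Pc x) by (intros x; apply continuous_clamp; [lra|apply CP]).
assert (CQc : forall x, continuous Qc x) by (intros x; apply continuous_clamp; auto).
assert (CTc : forall x, continuous Tc x) by (intros x; apply continuous_clamp; auto).
assert (Pc0 : forall x, 0 < Pc x) by (intros x; apply P0, clamp_itv; lra).
assert (Dp' : forall x, on_itv a b x -> is_derive p x (Qc x * U x)).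
{ intros x Hx. eapply is_derive_eq; [now apply Dp|]. unfold clamp; ring. }
set (M := fun x => RInt (fun t => U t * Tc t) a x).
set (N := fun x => RInt (fun t => V t * Tc t) a x).
assert (Cmul : forall f, (forall x, continuous f x) -> forall x, continuous (fun t => f t * Tc t) x).
{ intros f Cf x. pose proof (Cf x). pose proof (CTc x). continuity_rec. }
assert (JF : jacobi_fields a b Pc Qc Tc U p V q M N).
{ constructor; auto.
  - intros x _. now apply (@is_derive_primitive (fun t => U t * Tc t) a), Cmul.
  - intros x _. now apply (@is_derive_primitive (fun t => V t * Tc t) a), Cmul.
  - apply (RInt_point (V := R_CompleteNormedModule)).
  - apply (RInt_point (V := R_CompleteNormedModule)).
  - intros Ua. destruct Hunz as (x & Hx & Ux). apply Ux. rewrite <- EU by assumption.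
    now apply (homogeneous_uniqueness CPc CQc Pc0 DU Dp' Ua Pa Hx). }
assert (ED : forall x, on_itv a b x -> determinant U V M N x = - Delta x).
{ intros x Hx.
  assert (E : forall f g, (forall t, on_itv a b t -> f t = g t) ->
    RInt (fun t => f t * Tc t) a x = RInt (fun t => g t * T t) a x).
  { intros f g Hfg. apply (RInt_ext (V := R_CompleteNormedModule)). intros t.
    destruct Hx as [Hx1 Hx2]. rewrite Rmin_left, Rmax_right by lra. intros Ht.
    assert (on_itv a b t) by (unfold on_itv; lra).
    unfold Tc. now rewrite Hfg, clamp_eq. }
  unfold determinant, Delta, M, N, m, n. rewrite (E U u EU), (E V v EV), EU, EV by assumption. ring. }
split.
(* Necessity: a zero of [Delta] at [c] produces an admissible nontrivial [h] whose second variation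
   is 0. *)
- intros Hpos c Hc HD.
  assert (Hcin : on_itv a b c) by (unfold on_itv; lra).
  assert (HTc : not_identically_zero a c Tc).
  { destruct (HT c Hc) as (x & [Hx1 Hx2] & Tx). exists x. split; [split; assumption|].
    unfold Tc. rewrite clamp_eq; [assumption|unfold on_itv; lra]. }
  destruct (degenerate_variation JF Hc) as (w & r & Dw & Cr & Ra0 & Wc & Wnz & I1 & I2).
  { rewrite ED, HD by assumption. ring. }
  { exact HTc. }
  assert (Hin : forall x, on_itv a c x -> on_itv a b x) by (unfold on_itv; intros; lra).
  destruct (@extension_by_zero a b c w (fun x => r x / Pc x) Hc)
    as (Hsm & Hd & Hhw & Hh0 & Hdw & Hd0); auto.
  { intros x Hx. pose proof (Cr x (Hin x Hx)). pose proof (CPc x). continuity_rec.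
    specialize (Pc0 x). lra. }
  { rewrite Ra0. unfold Rdiv; ring. }
  set (h := clamp a c w) in *.
  assert (Hb : h b = 0) by (apply Hh0; lra).
  assert (S0 : second_variation a b P Q Rc h = 0).
  { unfold second_variation, end_diff. rewrite Hb, Ra.
    rewrite (is_RInt_unique (V := R_CompleteNormedModule) _ a b 0); [ring|].
    refine (is_RInt_extension_by_zero _ _ _ _ I2); [assumption| |].
    - intros x Hx. rewrite Hdw, Hhw by (unfold on_itv; lra).
      unfold Pc, Qc. rewrite !clamp_eq by (unfold on_itv; lra). reflexivity.
    - intros x Hx. rewrite Hd0, Hh0 by lra. ring. }
  apply (Rlt_irrefl 0). rewrite <- S0 at 2. apply Hpos; auto.
  + destruct Wnz as (x & Hx & Wx). exists x. split; [auto|]. now rewrite Hhw.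
  + unfold end_diff. rewrite Hb, Ga.
    rewrite (is_RInt_unique (V := R_CompleteNormedModule) _ a b 0); [ring|].
    refine (is_RInt_extension_by_zero _ _ _ _ I1); [assumption| |].
    * intros x Hx. rewrite Hhw by (unfold on_itv; lra).
      unfold Tc. rewrite !clamp_eq by (unfold on_itv; lra). reflexivity.
    * intros x Hx. rewrite Hh0 by lra. ring.
(* Sufficiency: the boundary terms vanish, so the second variation is the quadratic integral, and
   the constraint says that the primitive of [h T] vanishes at [b]. *)
- intros HD h Hsm Hnz _ Hb Hcons.
  set (hc := clamp a b h).
  assert (Chc : forall x, continuous hc x) by (intros x; apply continuous_clamp; [lra|apply Hsm]).
  assert (Ehc : forall x, on_itv a b x -> hc x = h x) by (intros; now apply clamp_eq).
  destruct (@second_variation_positive _ _ _ _ _ _ _ _ _ _ _ JF hc (deriv_on a b h)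
    (fun x => RInt (fun t => hc t * Tc t) a x)) as (I & I0 & HI); auto.
  + intros x Hx E. apply (HD x Hx). rewrite ED in E by (unfold on_itv; lra). lra.
  + now apply piecewise_smooth_C1.
  + intros x. now apply (@is_derive_primitive (fun t => hc t * Tc t) a), Cmul.
  + apply (RInt_point (V := R_CompleteNormedModule)).
  + rewrite (RInt_ext (V := R_CompleteNormedModule) _ (fun t => h t * T t)).
    * unfold end_diff in Hcons. rewrite Ga, Hb in Hcons. lra.
    * intros t. rewrite Rmin_left, Rmax_right by lra. intros Ht.
      unfold Tc, hc. rewrite !clamp_eq by (unfold on_itv; lra). reflexivity.
  + rewrite Ehc; [assumption|unfold on_itv; lra].
  + destruct Hnz as (x & Hx & Nx). exists x. split; [assumption|]. now rewrite Ehc.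
  + unfold second_variation, end_diff. rewrite Hb, Ra.
    rewrite (is_RInt_unique (V := R_CompleteNormedModule) _ a b I); [lra|].
    apply is_RInt_ext with (2 := HI). intros x. rewrite Rmin_left, Rmax_right by lra.
    intros Hx. unfold Pc, Qc, hc. rewrite !clamp_eq by (unfold on_itv; lra). reflexivity.
Qed.
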